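(* For all integers $r\geq 3$ and $\ell\geq 3$ there exists a constant $\alpha_{r,\ell}>0$, depending only on $r$ and $\ell$, such that for every positive integer $n$, $$ex_L(n,C^r_\ell)\leq \alpha_{r,\ell}\, n^{1+\frac{1}{\lfloor \ell/2\rfloor}}.$$
   Context: An $r$-graph is an $r$-uniform hypergraph. A hypergraph is linear if every two distinct edges share at most one vertex. For $\ell\geq 3$, the $r$-uniform linear cycle $C^r_\ell$ is the $r$-graph with edges $e_1,\ldots,e_\ell$ such that $|e_i\cap e_{i+1}|=1$ for $i\in[\ell-1]$, $|e_\ell\cap e_1|=1$, and $e_i\cap e_j=\emptyset$ for all other pairs $i\neq j$. For a linear $r$-graph $F$, the linear Turán number $ex_L(n,F)$ is the maximum number of edges of a linear $r$-graph on $n$ vertices that contains no subgraph isomorphic to $F$. *)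

(* Defs.v *)
From mathcomp Require Import all_boot.
From mathcomp Require Import zify.

Set Implicit Arguments.
Unset Strict Implicit.
Unset Printing Implicit Defensive.

(* A hypergraph with vertex set the finite type T is given by its edge set
   E : {set {set T}}. *)

Definition uniform (T : finType) (r : nat) (E : {set {set T}}) : bool :=
  [forall e in E, #|e| == r].

Definition linear_hypergraph (T : finType) (E : {set {set T}}) : bool :=
  [forall e in E, forall f in E, (e != f) ==> (#|e :&: f| <= 1)].

(* E contains a (not necessarily induced) subgraph isomorphic to F. *)
Definition contains_copy (V T : finType)
    (F : {set {set V}}) (E : {set {set T}}) : bool :=
  [exists f : {ffun V -> T},
     injectiveb f && [forall e in F, f @: e \in E]].

(* The maximum ranges over a nonempty family as soon as F has an edge, since
   the edgeless hypergraph is then admissible. *)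
Definition exL (r n : nat) (V : finType) (F : {set {set V}}) : nat :=
  \max_(E : {set {set 'I_n}} |
          [&& uniform r E, linear_hypergraph E & ~~ contains_copy F E]) #|E|.

(* C^r_l on l * (r - 1) cyclically ordered vertices: edge i consists of the r
   consecutive vertices i * (r - 1), ..., (i + 1) * (r - 1) modulo l * (r - 1).
   For l = 3 this is the triangle, whose three edges have no common vertex;
   prescribing only the sizes of the pairwise intersections would also allow
   three edges through a single vertex. *)
Definition cycle_edge (r l : nat) (i : 'I_l) : {set 'I_(l * r.-1)} :=
  [set v : 'I_(l * r.-1) |
     [exists j : 'I_r, v == (i * r.-1 + j) %% (l * r.-1) :> nat]].

Definition linear_cycle (r l : nat) : {set {set 'I_(l * r.-1)}} :=
  [set cycle_edge r i | i : 'I_l].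

Lemma mem_cycle_edge (r l : nat) (i : 'I_l) (v : 'I_(l * r.-1)) :
  2 <= r -> 3 <= l ->
  (v \in cycle_edge r i) = (v %/ r.-1 == i) || (v == ordS i * r.-1 :> nat).
Proof.
move=> r2 l3; rewrite inE /=.
have m0 : 0 < r.-1 by lia.
have il := ltn_ord i.
have Hm : (i.+1 %% l) * r.-1 = (i * r.-1 + r.-1) %% (l * r.-1).
  by rewrite muln_modl mulSn addnC.
have lt_lm k : k < r.-1 -> i * r.-1 + k < l * r.-1.
  move=> kr; apply: (@leq_trans (i.+1 * r.-1)); last by rewrite leq_mul2r il orbT.
  by rewrite mulSn addnC ltn_add2r.
apply/existsP/orP => [[j /eqP vj]|[/eqP vi|/eqP vi]].
- case: (ltnP j r.-1) => jr; [left|right].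
  + by rewrite vj modn_small ?lt_lm // divnMDl // divn_small // addn0.
  + by have jE : j = r.-1 :> nat; [have := ltn_ord j; lia | rewrite Hm vj jE].
- have jr : v %% r.-1 < r by have := ltn_pmod v m0; lia.
  exists (Ordinal jr) => /=; apply/eqP.
  by rewrite modn_small ?lt_lm ?ltn_pmod // -vi -divn_eq.
- have jr : r.-1 < r by lia.
  by exists (Ordinal jr) => /=; rewrite vi /= Hm.
Qed.

Lemma linear_cycleP (r l : nat) : 2 <= r -> 3 <= l ->
  [/\ forall i : 'I_l, #|cycle_edge r i| = r,
      forall i : 'I_l, #|cycle_edge r i :&: cycle_edge r (ordS i)| = 1
    & forall i j : 'I_l, i != j -> j != ordS i -> i != ordS j ->
        [disjoint cycle_edge r i & cycle_edge r j]].
Proof.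
move=> r2 l3; have m0 : 0 < r.-1 by lia.
have lm0 : 0 < l * r.-1 by rewrite muln_gt0 m0; lia.
have rlm : r <= l * r.-1 by apply: leq_trans (leq_mul l3 (leqnn _)); lia.
split=> [i|i|i j ij ji1 ij1].
- pose f (j : 'I_r) := Ordinal (ltn_pmod (i * r.-1 + j) lm0).
  have finj : injective f.
    move=> j k /(congr1 val)/= /eqP; rewrite eqn_modDl !modn_small.
    + by move/eqP/val_inj.
    + exact: leq_trans (ltn_ord k) rlm.
    + exact: leq_trans (ltn_ord j) rlm.
  rewrite -[RHS]card_ord -(card_imset _ finj); apply: eq_card => v.
  rewrite inE; apply/existsP/imsetP => [[j /eqP vj]|[j _ ->]]; exists j => //.
  exact: val_inj.
- have wlt : ordS i * r.-1 < l * r.-1 by rewrite ltn_mul2r m0 ltn_ord.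
  apply/eqP/cards1P; exists (Ordinal wlt); apply/setP=> v.
  rewrite in_setI !mem_cycle_edge // in_set1 -val_eqE /=.
  case: (eqVneq (v : nat) _) => [->|vn]; first by rewrite orbT mulnK // eqxx.
  rewrite orbF; apply/negP => /andP[/eqP vi /orP[/eqP vSi|/eqP vSSi]].
    have := ltn_ord i; move: vSi; rewrite vi /=.
    case: (eqVneq i.+1 l) => [Sil|Sil]; first by rewrite Sil modnn; lia.
    by move=> + il; rewrite modn_small; lia.
  move: vi; rewrite vSSi mulnK // => Hi.
  have := ltn_ord i; move: Hi => /=.
  case: (eqVneq i.+1 l) => [Sil|Sil]; first by rewrite Sil modnn modn_small; lia.
  move=> + il; rewrite (@modn_small i.+1 l); last by lia.
  case: (eqVneq i.+2 l) => [SSil|SSil]; first by rewrite SSil modnn; lia.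
  by rewrite modn_small; lia.
- rewrite -setI_eq0; apply/eqP/setP=> v; rewrite in_setI !mem_cycle_edge // inE.
  apply/negP => /andP[/orP[] /eqP vi /orP[] /eqP vj].
  + by case/eqP: ij; apply: val_inj; rewrite /= -vi -vj.
  + by case/eqP: ij1; apply: val_inj; rewrite /= -vi vj mulnK.
  + by case/eqP: ji1; apply: val_inj; rewrite /= -vj vi mulnK.
  + case/eqP: ij; apply: ordS_inj; apply: val_inj.
    by apply/eqP; rewrite -(eqn_pmul2r m0) -vi -vj.
Qed.

(* Main.v *)
Require Import Defs.
From mathcomp Require Import all_boot all_order all_algebra.
From mathcomp Require Import reals exp.
From mathcomp Require Import zify.

Set Implicit Arguments.
Unset Strict Implicit.
Unset Printing Implicit Defensive.

(* After deleting vertices of small degree, every non-isolated vertex of E has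
   degree larger than D, of order |E| / n.  From a root x one grows sets
   L_0 = {x}, L_1, L_2, ... such that every u in L_i is the end of a linear path
   of i edges from x, and a function [pos] tells on which edge of such a path,
   and in which role, a vertex may occur.  Averaging over random colourings of
   the vertices, a constant fraction of the D |L_i| edges leaving L_i have their
   other vertices off all the retained paths and come with two distinguished
   vertices, W f and S f.  If the vertices W f, or the vertices S f, are
   numerous, they form L_(i+1).  Otherwise the edges f joining the end U f of
   a path to W f (l even), or W f to S f (l odd), form a dense graph on few
   vertices, each of them the end of a path from x.  For each such f, the two
   paths that end on f are cut at their last common vertex v.  A second random
   colouring keeps the cut paths disjoint from the dense graph and from each
   other, v is constant along every connected part of that graph, and a greedy
   path of suitable odd length in it closes a linear cycle of length l.  Hence
   |L_(i+1)| >= c D |L_i| for i < k := l/2, so that (c D)^k <= |L_k| <= n. *)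

(** * Averaging *)

Lemma card_agree (T K : finType) (D : {set T}) (g : T -> K) :
  #|[set c : {ffun T -> K} | [forall z in D, c z == g z]]| * #|K| ^ #|D|
    = #|K| ^ #|T|.
Proof.
have -> : #|[set c : {ffun T -> K} | [forall z in D, c z == g z]]|
    = \prod_z (if z \in D then 1 else #|K|).
  pose P z := [pred k | (z \in D) ==> (k == g z)].
  have -> : #|[set c : {ffun T -> K} | [forall z in D, c z == g z]]|
      = #|(family P : simpl_pred {ffun T -> K})|.
    apply: eq_card => c; rewrite inE.
    by apply/forallP/familyP => h z; have := h z; rewrite inE.
  rewrite card_family foldrE big_map big_enum /=; apply: eq_bigr => z _.
  case: (boolP (z \in D)) => zD.
    by rewrite -(card1 (g z)); apply: eq_card => k; rewrite !inE.
  by apply: eq_card => k; rewrite !inE.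
have -> : #|K| ^ #|D| = \prod_z (if z \in D then #|K| else 1).
  by rewrite -big_mkcond /= prod_nat_const.
rewrite -big_split /= -prod_nat_const; apply: eq_bigr => z _.
by case: ifP => _; rewrite ?mul1n ?muln1.
Qed.

(** First moment over uniform colourings: by [card_agree] a fixed [a] is coloured as prescribed with
    probability at least [1 / #|K| ^ N], and some colouring does at least as well as the mean. *)
Lemma exists_coloring (T A K : finType) (F : {set A}) (D : A -> {set T})
    (g : A -> T -> K) (N : nat) :
  0 < #|K| -> (forall a, a \in F -> #|D a| <= N) ->
  exists c : {ffun T -> K},
    #|F| <= #|[set a in F | [forall z in D a, c z == g a z]]| * #|K| ^ N.
Proof.
move=> K0 DN.
pose S (c : {ffun T -> K}) := [set a in F | [forall z in D a, c z == g a z]].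
apply/existsP; case: (boolP [exists c, _]) => // /existsPn hn.
(* If every colouring fails, strictness is worth one unit per colouring; this surplus of
   [#|K| ^ #|T|] contradicts the double count below. *)
have : \sum_(c : {ffun T -> K}) (#|S c| * #|K| ^ N).+1
    <= \sum_(c : {ffun T -> K}) #|F|.
  by apply: leq_sum => c _; have := hn c; rewrite -ltnNge.
rewrite sum_nat_const.
have -> : #|{: {ffun T -> K}}| = #|K| ^ #|T| by rewrite card_ffun.
have -> : \sum_(c : {ffun T -> K}) (#|S c| * #|K| ^ N).+1
    = (\sum_(c : {ffun T -> K}) #|S c|) * #|K| ^ N + #|K| ^ #|T|.
  under eq_bigr do rewrite -addn1.
  by rewrite big_split /= sum1_card card_ffun big_distrl.
have -> : \sum_(c : {ffun T -> K}) #|S c|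
    = \sum_(a in F) #|[set c : {ffun T -> K} | [forall z in D a, c z == g a z]]|.
  under [LHS]eq_bigr do rewrite -sum1_card.
  rewrite (exchange_big_dep (mem F)) /=; last by move=> c a _; rewrite inE => /andP[].
  apply: eq_bigr => a aF; rewrite -sum1_card; apply: eq_bigl => c.
  by rewrite !inE aF.
rewrite big_distrl /=.
have : \sum_(a in F) #|K| ^ #|T| <= \sum_(a in F)
   #|[set c : {ffun T -> K} | [forall z in D a, c z == g a z]]| * #|K| ^ N.
  apply: leq_sum => a aF; rewrite -(card_agree (D a) (g a)) leq_mul2l.
  by rewrite leq_pexp2l ?DN ?orbT.
rewrite sum_nat_const mulnC => h1 h2.
have := leq_trans h2 h1.
by rewrite -[leqRHS]addn0 leq_add2l leqn0 expn_eq0 (gtn_eqF K0).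
Qed.

(** Repeatedly delete an index of degree at most [D] with everything incident to it. At most
    [D * #|I|] elements go, so some survive, and none of them is incident to a deleted index. *)
Lemma exists_min_degree (A B : finType) (I : {set B}) (inc : A -> B -> bool)
    (D : nat) (F : {set A}) :
  D * #|I| < #|F| ->
  exists F' : {set A}, [/\ F' \subset F, F' != set0 &
    forall b a, b \in I -> a \in F' -> inc a b ->
      D < #|[set a in F' | inc a b]|].
Proof.
have [m] := ubnP #|I|; elim: m I F => // m IH I F Im DF.
case: (boolP [exists b in I, #|[set a in F | inc a b]| <= D]).
  case/exists_inP=> b bI bD.
  have cI := cardsD1 b I; rewrite bI in cI.
  pose F1 := [set a in F | ~~ inc a b].
  have cF : #|F| = #|[set a in F | inc a b]| + #|F1|.
    rewrite -(cardsID [set a | inc a b] F); congr (_ + _);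
      by apply: eq_card => a; rewrite !inE ?[_ && (a \in F)]andbC.
  case: (IH (I :\ b) F1); [lia | nia |] => F' [F'F F'0 hF'].
  exists F'; split => //.
    by apply: subset_trans F'F _; apply/subsetP=> a; rewrite inE => /andP[].
  move=> b' a b'I aF' ab'; case: (eqVneq b' b) => [bb|nbb].
    by have := subsetP F'F a aF'; rewrite inE -bb ab' andbF.
  by apply: (hF' _ a) => //; rewrite !inE nbb.
move=> /exists_inPn h; exists F; split=> //.
- by rewrite -card_gt0; lia.
- by move=> b a bI _ _; have := h b bI; rewrite -ltnNge.
Qed.

(** * Linear paths and cycles *)

Section LinearPaths.

Variables (V : finType) (E : {set {set V}}).

Implicit Types (v w x y z : V) (e f : {set V}) (es : seq {set V}).

Definition pverts v es : {set V} :=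
  v |: \bigcup_(e <- es) e.

(** Each edge is compared with the whole remaining path, and [v != w] keeps a joint off the third
    edge; together they make nonconsecutive edges disjoint. *)
Fixpoint lpath v es x : Prop :=
  if es is e :: t then
    exists w, [/\ e \in E, v \in e, v != w, e :&: pverts w t = [set w]
      & lpath w t x]
  else v = x.

Lemma pverts0 v : pverts v [::] = [set v].
Proof. by rewrite /pverts big_nil setU0. Qed.

Lemma pverts_cons v w e es : v \in e -> w \in e ->
  pverts v (e :: es) = e :|: pverts w es.
Proof.
move=> ve we; apply/setP=> z; rewrite /pverts big_cons !inE.
by do 2![case: eqP => [->|_]]; rewrite ?ve ?we ?orbT.
Qed.

Lemma pverts_start v es : v \in pverts v es.
Proof. by rewrite !inE eqxx. Qed.

Lemma pverts_cat v w es1 es2 : w \in pverts v es1 ->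
  pverts v (es1 ++ es2) = pverts v es1 :|: pverts w es2.
Proof.
move=> wv; apply/setP=> z; move: wv.
rewrite /pverts big_cat /= !inE.
by case: (eqVneq z w) => [->|_]; case: eqP => //=; rewrite ?orbA //= => _ ->.
Qed.

Lemma pverts_rcons v w es e : w \in pverts v es -> w \in e ->
  pverts v (rcons es e) = pverts v es :|: e.
Proof.
move=> wv we; rewrite -cats1 (pverts_cat _ wv) (@pverts_cons _ w) // pverts0.
by congr (_ :|: _); apply/setUidPl; rewrite sub1set.
Qed.

Lemma setI_eq1_in (S T : {set V}) w : S :&: T = [set w] -> w \in S /\ w \in T.
Proof. by move=> h; apply/andP; rewrite -in_setI h set11. Qed.

Lemma setI_eq1P (S T : {set V}) w z :
  S :&: T = [set w] -> z \in S -> z \in T -> z = w.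
Proof.
by move=> h zS zT; apply/eqP; rewrite -in_set1 -h inE zS.
Qed.

Lemma setI_eq1 (S T : {set V}) w : w \in S -> w \in T ->
  (forall z, z \in S -> z \in T -> z = w) -> S :&: T = [set w].
Proof.
move=> wS wT h; apply/setP=> z; rewrite !inE.
apply/andP/eqP => [[]|->//]; exact: h.
Qed.

Lemma lpath_end v es x : lpath v es x -> x \in pverts v es.
Proof.
elim: es v => [|e t IH] v /=; first by move=> ->; rewrite pverts_start.
case=> w [_ ve _ /setI_eq1_in[we _] /IH xw].
by rewrite (pverts_cons t ve we) inE xw orbT.
Qed.

Lemma lpath_cat v w x es1 es2 : lpath v es1 w -> lpath w es2 x ->
  pverts v es1 :&: pverts w es2 = [set w] -> lpath v (es1 ++ es2) x.
Proof.
elim: es1 v => [|e t IH] v /=; first by move=> ->.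
case=> w0 [eE ve nvw ew pw0] pw.
have [w0e _] := setI_eq1_in ew; have ww0 := lpath_end pw0.
rewrite (pverts_cons t ve w0e) => h.
exists w0; split=> //; last first.
  apply: IH => //; apply: setI_eq1; rewrite ?pverts_start // => z z1 z2.
  by apply: (setI_eq1P h) => //; rewrite inE z1 orbT.
rewrite (pverts_cat _ ww0); apply: setI_eq1; rewrite ?inE ?eqxx // => z ze.
rewrite inE => /orP[z2|z2]; first exact: (setI_eq1P ew).
have zw : z = w by apply: (setI_eq1P h) => //; rewrite inE ze.
by apply: (setI_eq1P ew) => //; rewrite zw.
Qed.

Lemma lpath1 v e x : e \in E -> v \in e -> x \in e -> v != x ->
  lpath v [:: e] x.
Proof.
move=> eE ve xe nvx; exists x; split=> //; rewrite pverts0.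
by apply/setIidPr; rewrite sub1set.
Qed.

Lemma lpath_rcons v w x es e : lpath v es w -> e \in E -> x \in e -> w != x ->
  pverts v es :&: e = [set w] -> lpath v (rcons es e) x.
Proof.
move=> pw eE xe nwx ew; have [_ we] := setI_eq1_in ew.
rewrite -cats1; apply: lpath_cat pw (lpath1 eE we xe nwx) _.
by rewrite (pverts_cons _ we we) pverts0 (setUidPl _) // sub1set.
Qed.

Lemma lpath_rev v es x : lpath v es x ->
  lpath x (rev es) v /\ pverts x (rev es) = pverts v es.
Proof.
elim: es v => [|e t IH] v /=; first by move=> ->.
case=> w [eE ve nvw ew /IH[p1 p2]].
have [we _] := setI_eq1_in ew.
have wt : w \in pverts x (rev t) by rewrite p2 pverts_start.
rewrite rev_cons (pverts_rcons wt we) (pverts_cons _ ve we) p2 setUC; split=> //.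
by apply: lpath_rcons p1 eE ve _ _; rewrite 1?eq_sym // p2 setIC.
Qed.

(** Orders the vertices as [linear_cycle] numbers them: an edge contributes its entry vertex and
    then its inner vertices, while its exit vertex opens the block of the next edge. Edges thus
    become windows of length [r] at multiples of [r.-1]. *)
Lemma lpath_seq (r : nat) v es x : 2 <= r -> uniform r E -> lpath v es x ->
  exists s, [/\ uniq (rcons s x), size s = size es * r.-1,
    head x s = v, {subset s <= pverts v es} &
    forall i, i < size es ->
      [set z in take r (drop (i * r.-1) (rcons s x))] \in E].
Proof.
move=> r2 /forallP hu; elim: es v => [|e t IH] v /=.
  by move=> ->; exists [::].
case=> w [eE ve nvw ew pw]; have xw := lpath_end pw.
have [we _] := setI_eq1_in ew.
have [s [us ss hs sub win]] := IH _ pw.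
have ce : #|e| = r by have := implyP (hu e) eE; move/eqP.
pose m := enum (e :\ v :\ w).
have sm : size m = r.-2.
  rewrite /m -cardE.
  have := cardsD1 v e; have := cardsD1 w (e :\ v).
  by rewrite ve !inE eq_sym nvw we ce => -> /= ->.
have hr : r = r.-2.+2 by lia.
have sub' z : z \in rcons s x -> z \in pverts w t.
  by rewrite mem_rcons inE => /orP[/eqP->//|/sub].
have hrc : rcons s x = w :: behead (rcons s x).
  by case: (s) hs => [|a b] /= <-.
exists (v :: m ++ s); split.
- rewrite rcons_cons rcons_cat /= cat_uniq mem_cat us enum_uniq andbT /=.
  apply/andP; split.
    rewrite negb_or mem_enum !inE eqxx andbF /=.
    apply: contra nvw => /sub' vt; apply/eqP; exact: (setI_eq1P ew).
  apply/hasPn => z /sub' zt; rewrite mem_enum !inE negb_and negbK.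
  rewrite negb_and; case: (boolP (z \in e)) => ze; last by rewrite !orbT.
  by rewrite (setI_eq1P ew ze zt) eqxx.
- by rewrite /= size_cat sm ss mulSn; lia.
- by [].
- move=> z; rewrite inE mem_cat (pverts_cons _ ve we) inE.
  case/or3P=> [/eqP->|zm|/sub ->]; rewrite ?ve ?orbT //.
  by move: zm; rewrite mem_enum !inE => /and3P[_ _ ->].
- case=> [_|i]; last first.
    rewrite ltnS => /win; rewrite rcons_cons rcons_cat mulSn.
    have -> : r.-1 + i * r.-1 = (r.-2 + i * r.-1).+1 by lia.
    by rewrite /= drop_cat sm ltnNge leq_addr /= addKn.
  rewrite mul0n drop0 rcons_cons rcons_cat hrc hr /= take_cat sm.
  have -> : r.-2.+1 < r.-2 = false by lia.
  have -> : r.-2.+1 - r.-2 = 1 by lia.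
  rewrite /= take0; suff -> : [set z in v :: m ++ [:: w]] = e by [].
  apply/setP=> z; rewrite !inE mem_cat mem_enum !inE.
  case: (eqVneq z v) => [->|_]; first by rewrite ve.
  by case: (eqVneq z w) => [->|_]; rewrite ?we ?orbT ?orbF.
Qed.

(** The first path and the reversed second one run once round the cycle. Each list from [lpath_seq]
    omits its final vertex, which heads the other list, so [s1 ++ s2] consists of [l * r.-1]
    distinct vertices. *)
Lemma lpaths_contain_cycle (r l : nat) v y es1 es2 :
  2 <= r -> 0 < l -> uniform r E -> v != y ->
  lpath v es1 y -> lpath v es2 y -> size es1 + size es2 = l ->
  pverts v es1 :&: pverts v es2 = [set v; y] ->
  contains_copy (linear_cycle r l) E.
Proof.
move=> r2 l0 hu nvy p1 /lpath_rev[p2 pv2] sz hI.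
have [s1 [u1 ss1 h1 sub1 win1]] := lpath_seq r2 hu p1.
have [s2 [u2 ss2 h2 sub2 win2]] := lpath_seq r2 hu p2.
rewrite pv2 in sub2; rewrite size_rev in ss2 win2.
have q0 : 0 < r.-1 by lia.
have hr' : r = r.-1.+1 by lia.
have st : size (s1 ++ s2) = l * r.-1 by rewrite size_cat ss1 ss2 -sz mulnDl.
have vy2 : y \in rcons s2 v.
  by case: (s2) h2 => [/eqP|a b /= ->]; rewrite ?(negbTE nvy) ?inE ?eqxx.
have v1 : v \in rcons s1 y.
  by case: (s1) h1 => [/eqP|a b /= ->]; rewrite 1?eq_sym ?(negbTE nvy) ?inE ?eqxx.
have ut : uniq (s1 ++ s2).
  move: u1 u2; rewrite !rcons_uniq cat_uniq => /andP[y1 ->] /andP[v2 ->] /=.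
  rewrite andbT; apply/hasPn => z z2; apply/negP => z1.
  have : z \in [set v; y] by rewrite -hI inE (sub1 _ z1) (sub2 _ z2).
  rewrite !inE => /orP[] /eqP zE; first by rewrite zE (negbTE v2) in z2.
  by rewrite zE (negbTE y1) in z1.
pose f := [ffun i : 'I_(l * r.-1) => nth v (s1 ++ s2) i].
apply/existsP; exists f; apply/andP; split.
  apply/injectiveP=> i j; rewrite !ffunE => /eqP.
  by rewrite nth_uniq ?st // => /eqP/val_inj.
apply/forall_inP=> _ /imsetP[i _ ->].
have n0 : 0 < l * r.-1 by rewrite muln_gt0 l0.
have iq : i * r.-1 + r.-1 <= l * r.-1.
  by rewrite addnC -mulSn leq_pmul2r.
(* The last window wraps round to position 0; appending [v], the head of [s1], makes it an ordinary
   window. *)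
have -> : f @: cycle_edge r i
    = [set z in take r (drop (i * r.-1) (s1 ++ rcons s2 v))].
  have sz2 : size (take r (drop (i * r.-1) (s1 ++ rcons s2 v))) = r.
    rewrite size_takel // size_drop -rcons_cat size_rcons st.
    by move: iq hr'; move: (i * r.-1) (l * r.-1) r.-1 => a b q; lia.
  have nthE j : j < r -> nth v (s1 ++ s2) ((i * r.-1 + j) %% (l * r.-1))
      = nth v (take r (drop (i * r.-1) (s1 ++ rcons s2 v))) j.
    move=> jr; rewrite nth_take // nth_drop -rcons_cat nth_rcons st.
    case: ltngtP => [lt|gt|eq]; first by rewrite modn_small.
    - lia.
    - rewrite eq modnn; case: (s1) h1 => [/= h|a b /= -> //].
      by rewrite h eqxx in nvy.
  apply/setP=> z; rewrite inE; apply/imsetP/idP => [[k] | zt].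
    rewrite inE => /existsP[j /eqP kj] ->; rewrite ffunE kj nthE //.
    by rewrite mem_nth // sz2.
  case/(nthP v): zt => j; rewrite sz2 => jr <-.
  exists (Ordinal (ltn_pmod (i * r.-1 + j) n0)).
    by rewrite inE; apply/existsP; exists (Ordinal jr).
  by rewrite ffunE /= nthE.
case: (ltnP i (size es1)) => ie.
  have := win1 i ie; congr (_ \in E); apply/setP=> z; rewrite !inE.
  congr (z \in _).
  have hrc : rcons s2 v = y :: behead (rcons s2 v).
    by case: (s2) h2 => [|a b] /= <-.
  have le1 : i * r.-1 + r.-1 <= size s1.
    by rewrite ss1 addnC -mulSn leq_pmul2r.
  rewrite hrc -cat_rcons drop_cat size_rcons ifT; last by lia.
  rewrite take_cat size_drop size_rcons.
  case: ltnP => // ge.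
  have -> : r - ((size s1).+1 - i * r.-1) = 0 by lia.
  by rewrite take0 cats0 take_oversize // size_drop size_rcons.
have il : i - size es1 < size es2 by have := ltn_ord i; lia.
have := win2 _ il; rewrite drop_cat ss1 ltnNge leq_pmul2r // ie /=.
by rewrite mulnBl.
Qed.

End LinearPaths.

(** * Greedy extension of paths in linear hypergraphs *)

Section LinearHypergraph.

Variables (V : finType) (E : {set {set V}}) (r : nat).
Hypotheses (uE : uniform r E) (lE : linear_hypergraph E).

Implicit Types (u v w x y z : V) (e f : {set V}) (es : seq {set V}).

Lemma linear_edge_eq e f a b : e \in E -> f \in E -> a != b ->
  a \in e -> b \in e -> a \in f -> b \in f -> e = f.
Proof.
move=> eE fE nab ae be af bf; apply/eqP; apply: contraT => nef.
have := implyP (forall_inP (forall_inP lE e eE) f fE) nef.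
rewrite leqNgt => /negP[]; apply/card_gt1P; exists a, b.
by rewrite !inE ae be af bf.
Qed.

Lemma linear_edge_setI e f a : e \in E -> f \in E -> e != f ->
  a \in e -> a \in f -> e :&: f = [set a].
Proof.
move=> eE fE nef ae af; apply: setI_eq1 => // z ze zf.
by apply/eqP; apply: contraNT nef => nza; apply/eqP; apply: (@linear_edge_eq _ _ z a).
Qed.

(** Distinct edges through [z] share nothing else, so picking on each a vertex of [B] other than [z]
    is injective. *)
Lemma card_edges_meeting (B : {set V}) z :
  #|[set e in E | (z \in e) && ~~ (B :&: e \subset [set z])]| <= #|B|.
Proof.
set S := [set e in E | _].
pose h e := odflt z [pick b in B :&: e | b != z].
have hP e : e \in S -> [/\ e \in E, z \in e, h e \in B, h e \in e & h e != z].
  rewrite inE => /and3P[eE ze nsub]; rewrite /h; case: pickP => [b|none] /=.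
    by rewrite !inE => /andP[/andP[-> ->] ->].
  case/negP: nsub; apply/subsetP=> b bB; rewrite inE; apply: contraT => nbz.
  by have := none b; rewrite bB nbz.
have hinj : {in S &, injective h}.
  move=> e f /hP[eE ze _ he hz] /hP[fE zf _ hf _] eqh.
  by apply: (@linear_edge_eq _ _ (h e) z); rewrite // eqh.
rewrite -(card_in_imset hinj); apply/subset_leq_card/subsetP=> _ /imsetP[e eS ->].
by case/hP: eS.
Qed.

Lemma exists_avoiding_edge (F : {set {set V}}) (B : {set V}) z :
  F \subset E -> z \in B -> #|B| < #|[set e in F | z \in e]| ->
  exists2 e, e \in F & z \in e /\ B :&: e = [set z].
Proof.
move=> FE zB ltB.
case: (boolP [exists e in F, (z \in e) && (B :&: e \subset [set z])]).
  case/exists_inP=> e eF /andP[ze sub]; exists e => //; split=> //.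
  by apply/eqP; rewrite eqEsubset sub sub1set inE zB ze.
move=> /exists_inPn none; move: ltB; rewrite ltnNge => /negP[].
apply: leq_trans (card_edges_meeting B z); apply/subset_leq_card/subsetP=> e.
rewrite !inE => /andP[eF ze]; have := none e eF; rewrite ze /= => ->.
by rewrite (subsetP FE).
Qed.

Lemma card_pverts v es : all (mem E) es -> #|pverts v es| <= (size es * r).+1.
Proof.
move=> all_es; rewrite /pverts (leq_trans (leq_card_setU _ _)) // cards1 add1n ltnS.
elim: es all_es => [|e t IH] /=; first by rewrite big_nil cards0.
case/andP=> eE /IH le; rewrite big_cons (leq_trans (leq_card_setU _ _)) //.
by rewrite mulSn leq_add // (eqP (forall_inP uE e eE)).
Qed.

Lemma lpath_all v es x : lpath E v es x -> all (mem E) es.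
Proof. by elim: es v => //= e t IH v [w [-> _ _ _ /IH]]. Qed.

(** Each [f] acts as a graph edge from [X f] to [Y f]. The path never has more than [D] vertices, so
    by [exists_avoiding_edge] some edge of [F] leaves its current end without meeting it again. The
    roles alternate, whence the parity. *)
Lemma greedy_lpath (F : {set {set V}}) (X Y : {set V} -> V) (D : nat) f0 m :
  F \subset E -> f0 \in F ->
  (forall f, f \in F -> [/\ X f \in f, Y f \in f & X f != Y f]) ->
  (forall f, f \in F -> D < #|[set g in F | X g == X f]|) ->
  (forall f, f \in F -> D < #|[set g in F | Y g == Y f]|) ->
  (m * r).+1 <= D ->
  exists fs f, [/\ lpath E (X f0) fs (if odd m then Y f else X f), f \in F,
    size fs = m & all (mem F) fs].
Proof.
move=> FE f0F XY dX dY; elim: m => [|m IH] le.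
  by exists [::], f0; split.
case: IH => [|fs [f [pf fF szf allf]]].
  by apply: leq_trans le; rewrite ltnS leq_mul2r leqnSn orbT.
set z := (if odd m then _ else _) in pf.
have szp : #|pverts (X f0) fs| <= D.
  apply: leq_trans (card_pverts _ _) _.
    by apply: sub_all allf => e /(subsetP FE).
  by apply: leq_trans le; rewrite szf ltnS leq_mul2r leqnSn orbT.
(* [Z] is the role of the current end and [Z'] that of the next one. *)
pose Z e := if odd m then Y e else X e.
pose Z' e := if odd m then X e else Y e.
pose G := [set g in F | Z g == z].
have GF : G \subset F by apply/subsetP=> g; rewrite inE => /andP[].
have ZP g : g \in F -> [/\ Z g \in g, Z' g \in g & Z g != Z' g].
  by rewrite /Z /Z'; case: odd => /XY[] *; split; rewrite // eq_sym.
have [] := @exists_avoiding_edge G (pverts (X f0) fs) z.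
- exact: subset_trans FE.
- exact: lpath_end pf.
- have -> : [set e in G | z \in e] = G.
    apply/setP=> g; rewrite inE andbC; case: (boolP (g \in G)); rewrite ?andbF //.
    by rewrite inE => /andP[/ZP[h _ _] /eqP <-]; rewrite h.
  apply: leq_ltn_trans szp _; rewrite /G /Z /z.
  by case: odd; [apply: dY | apply: dX].
move=> g; rewrite inE => /andP[gF /eqP gz] [zg Ig].
have [_ z'g nz] := ZP g gF.
exists (rcons fs g), g; split=> //.
- have -> : (if odd m.+1 then Y g else X g) = Z' g by rewrite /Z' /=; case: odd.
  by apply: lpath_rcons pf (subsetP FE _ gF) z'g _ Ig; rewrite -gz.
- by rewrite size_rcons szf.
- by rewrite all_rcons allf /= gF.
Qed.

End LinearHypergraph.

(** * Closing a cycle *)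

Section CrossingPaths.

Variables (r l N : nat).

(* [inl (inl j)] and [inl (inr j)] mark the two ends of a crossing edge and
   prescribe the index of the candidate path to be used there; the three
   remaining colours are for the other vertices of the crossing edge and for the
   inner vertices of the two paths. *)
Definition cross_color : finType := (('I_N.+1 + 'I_N.+1) + 'I_3)%type.

(** The exponent bounds the vertices to be coloured: [r] on the crossing edge and [(l * r).+1] on
    each path. The last factor is the minimum degree that the greedy path asks for. *)
Definition cross_const : nat :=
  #|cross_color| ^ (r + 2 * (l * r).+1) * (l * r).+1.

(** Classes 0 and 1 are the [X]-ends and [Y]-ends, 2 the rest of the crossing edge, 3 and 4 the
    inner vertices of the first and second path. *)
Definition color_class (k : cross_color) : nat :=
  match k with inl (inl _) => 0 | inl (inr _) => 1 | inr i => 2 + i end.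

Definition color_index (k : cross_color) : nat :=
  match k with inl (inl j) => j | inl (inr j) => j | inr _ => 0 end.

Variables (V : finType) (E : {set {set V}}).
Hypotheses (r2 : 2 <= r) (uE : uniform r E) (lE : linear_hypergraph E).

(** Together with [f] the two paths form a linear cycle; a longer path of crossing edges will
    replace [f]. *)
Definition crosses (f : {set V}) (x y v : V) (Q Q' : seq {set V}) : Prop :=
  [/\ lpath E v Q x, lpath E v Q' y, pverts v Q :&: pverts v Q' = [set v],
    v \notin f & f :&: pverts v Q = [set x] /\ f :&: pverts v Q' = [set y]].

(** After colouring, an [X]-end determines [(v, Q)] and a [Y]-end determines [(v, Q')], so [v] and
    the path lengths are constant on connected parts of the graph with edges from [X f] to [Y f]. A
    greedy path there is closed by the [Q] of its start and the [Q'] of its end. *)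
Lemma crossing_paths_cycle (F : {set {set V}}) (X Y : {set V} -> V)
    (candX candY : V -> seq (V * seq {set V})) (d : nat) :
  F \subset E ->
  (forall f, f \in F -> size (candX (X f)) <= N) ->
  (forall f, f \in F -> size (candY (Y f)) <= N) ->
  (forall f, f \in F -> exists t : V * seq {set V} * seq {set V},
     let: (v, Q, Q') := t in
     [/\ (v, Q) \in candX (X f), (v, Q') \in candY (Y f),
       crosses f (X f) (Y f) v Q Q', X f != Y f
     & [/\ size Q' = size Q + d, size Q + size Q' < l
         & odd (l - (size Q + size Q'))]]) ->
  cross_const * (#|X @: F| + #|Y @: F|) < #|F| ->
  contains_copy (linear_cycle r l) E.
Proof.
move=> FE szX szY hF ltF.
pose good f (t : V * seq {set V} * seq {set V}) := let: (v, Q, Q') := t in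
     [/\ (v, Q) \in candX (X f), (v, Q') \in candY (Y f),
       crosses f (X f) (Y f) v Q Q', X f != Y f
     & [/\ size Q' = size Q + d, size Q + size Q' < l
         & odd (l - (size Q + size Q'))]].
have [t ht] : exists t, forall f, f \in F -> good f (t f).
  apply: (fin_all_exists (P := fun f t => f \in F -> good f t)) => f.
  case: (boolP (f \in F)) => fF; first by have [t ht] := hF f fF; exists t.
  by exists (X f, [::], [::]).
pose v f := (t f).1.1; pose Q f := (t f).1.2; pose Q' f := (t f).2.
have {}ht f : f \in F -> [/\ (v f, Q f) \in candX (X f), (v f, Q' f) \in candY (Y f),
       crosses f (X f) (Y f) (v f) (Q f) (Q' f), X f != Y f
     & [/\ size (Q' f) = size (Q f) + d, size (Q f) + size (Q' f) < l
         & odd (l - (size (Q f) + size (Q' f)))]].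
  by move=> /ht; rewrite /good /v /Q /Q'; case: (t f) => [[]].
clear hF.
pose jX f : 'I_N.+1 := inord (index (v f, Q f) (candX (X f))).
pose jY f : 'I_N.+1 := inord (index (v f, Q' f) (candY (Y f))).
(* The order of the tests matters: [X f] and [Y f] also lie on [f] and on a path, and must be marked
   as ends. *)
pose g f b : cross_color :=
  if b == X f then inl (inl (jX f)) else if b == Y f then inl (inr (jY f))
  else if b \in f then inr (inord 0)
  else if b \in pverts (v f) (Q f) then inr (inord 1) else inr (inord 2).
(* The vertex [v f] lies on both paths and gets no prescribed colour. *)
pose Dm f := (f :|: (pverts (v f) (Q f) :|: pverts (v f) (Q' f))) :\ v f.
have [||c hc] := @exists_coloring V _ cross_color F Dm g (r + 2 * (l * r).+1).
- by apply/card_gt0P; exists (inr ord0).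
- move=> f fF; have [_ _ [p1 p2 _ _ _] _ [_ ltl _]] := ht f fF.
  have c1 := card_pverts uE (v f) (lpath_all p1).
  have c2 := card_pverts uE (v f) (lpath_all p2).
  have cf : #|f| = r := eqP (forall_inP uE f (subsetP FE f fF)).
  have l1 : size (Q f) * r <= l * r by rewrite leq_mul2r; lia.
  have l2 : size (Q' f) * r <= l * r by rewrite leq_mul2r; lia.
  apply: leq_trans (subset_leq_card (subsetDl _ _)) _.
  rewrite (leq_trans (leq_card_setU _ _)) // cf leq_add2l.
  rewrite (leq_trans (leq_card_setU _ _)) // mul2n -addnn leq_add //.
  + exact: leq_trans c1 _.
  + exact: leq_trans c2 _.
set F1 := [set f in F | _] in hc.
have F1F f : f \in F1 -> f \in F by rewrite inE => /andP[].
have cg f b : f \in F1 -> b \in Dm f -> c b = g f b.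
  by rewrite inE => /andP[_ /forall_inP h] /h/eqP.
pose kc b := color_class (c b).
have hX f : f \in F1 -> X f \in f /\ X f \in pverts (v f) (Q f).
  by move=> /F1F/ht[_ _ [_ _ _ _ [/setI_eq1_in]]].
have hY f : f \in F1 -> Y f \in f /\ Y f \in pverts (v f) (Q' f).
  by move=> /F1F/ht[_ _ [_ _ _ _ [_ /setI_eq1_in]]].
have hv f b : f \in F1 -> b \in f -> b != v f.
  move=> /F1F/ht[_ _ [_ _ _ nvf _] _ _] bf.
  by apply: contraNneq nvf => <-.
have cX f : f \in F1 -> c (X f) = inl (inl (jX f)).
  move=> fF1; have [Xf _] := hX f fF1.
  by rewrite (cg f) // ?/g ?eqxx // !inE (hv f) // Xf.
have cY f : f \in F1 -> c (Y f) = inl (inr (jY f)).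
  move=> fF1; have [Yf _] := hY f fF1.
  have [_ _ _ nXY _] := ht f (F1F f fF1).
  by rewrite (cg f) // ?/g ?eqxx 1?eq_sym ?(negbTE nXY) // !inE (hv f) // Yf.
have kf f b : f \in F1 -> b \in f ->
    kc b <= 2 /\ (kc b = 0 -> b = X f) /\ (kc b = 1 -> b = Y f).
  move=> fF1 bf; rewrite /kc (cg f) // ?inE ?(hv f) ?bf // /g bf.
  by case: eqP => [->|_]; last case: eqP => [->|_]; rewrite //= inordK.
have kQ f b : f \in F1 -> b \in pverts (v f) (Q f) ->
    [\/ b = v f, b = X f | kc b = 3].
  move=> fF1 bQ; have [_ _ [_ _ IQ _ [fQ fQ']] _ _] := ht f (F1F f fF1).
  case: (eqVneq b (v f)) => [->|nbv]; first by constructor 1.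
  case: (eqVneq b (X f)) => [->|nbX]; first by constructor 2.
  have bD : b \in Dm f by rewrite in_setD1 nbv; apply/setUP; right; apply/setUP; left.
  constructor 3; rewrite /kc (cg f) // /g (negbTE nbX) bQ.
  case: (boolP (b \in f)) => bf.
    by rewrite (setI_eq1P fQ bf bQ) eqxx in nbX.
  case: eqP => [bY|_]; last by rewrite /= inordK.
  by rewrite bY (hY f fF1).1 in bf.
have kQ' f b : f \in F1 -> b \in pverts (v f) (Q' f) ->
    [\/ b = v f, b = Y f | kc b = 4].
  move=> fF1 bQ; have [_ _ [_ _ IQ _ [fQ fQ']] _ _] := ht f (F1F f fF1).
  case: (eqVneq b (v f)) => [->|nbv]; first by constructor 1.
  case: (eqVneq b (Y f)) => [->|nbY]; first by constructor 2.
  have bD : b \in Dm f by rewrite in_setD1 nbv; apply/setUP; right; apply/setUP; right.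
  constructor 3; rewrite /kc (cg f) // /g (negbTE nbY).
  case: (boolP (b \in f)) => bf.
    by rewrite (setI_eq1P fQ' bf bQ) eqxx in nbY.
  case: eqP => [bX|_]; first by rewrite bX (hX f fF1).1 in bf.
  case: (boolP (b \in _)) => [bQQ|_]; last by rewrite /= inordK.
  by rewrite (setI_eq1P IQ bQQ bQ) eqxx in nbv.
(* The colour of an end is an index into its candidate list, so the path is decoded from the end
   without knowing [f]. *)
pose qX z := nth (z, [::]) (candX z) (color_index (c z)).
pose qY z := nth (z, [::]) (candY z) (color_index (c z)).
have qXE f : f \in F1 -> qX (X f) = (v f, Q f).
  move=> fF1; have [cX1 _ _ _ _] := ht f (F1F f fF1).
  rewrite /qX cX //= inordK ?nth_index // ltnS.
  by apply: leq_trans (szX f (F1F f fF1)); rewrite ltnW // index_mem.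
have qYE f : f \in F1 -> qY (Y f) = (v f, Q' f).
  move=> fF1; have [_ cY1 _ _ _] := ht f (F1F f fF1).
  rewrite /qY cY //= inordK ?nth_index // ltnS.
  by apply: leq_trans (szY f (F1F f fF1)); rewrite ltnW // index_mem.
pose I := X @: F :|: Y @: F.
have [|F2 [F2F1 F20 deg]] := @exists_min_degree _ _ I
   (fun f z => (X f == z) || (Y f == z)) (l * r).+1 F1.
  rewrite ltnNge; apply/negP => leF1; move: ltF; rewrite ltnNge => /negP[].
  rewrite /cross_const (leq_trans hc) // mulnC -mulnA leq_mul2l; apply/orP; right.
  apply: leq_trans leF1 _; rewrite leq_mul2l; apply/orP; right.
  exact: leq_card_setU.
have {}F2F1 f : f \in F2 -> f \in F1 by apply: (subsetP F2F1).
(* The two kinds of ends have different colours, so all incidences counted at [X f] are of the kind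
   [X]. *)
have dX f : f \in F2 -> (l * r).+1 < #|[set h in F2 | X h == X f]|.
  move=> fF2; have -> : [set h in F2 | X h == X f]
      = [set h in F2 | (X h == X f) || (Y h == X f)].
    apply/setP=> h; rewrite !inE; apply: andb_id2l => hF2.
    case: (eqVneq (Y h) (X f)); rewrite ?orbF // => YX.
    by have := cX f (F2F1 f fF2); rewrite -YX cY ?F2F1.
  apply: (deg _ f) => //; last by rewrite eqxx.
  by rewrite inE; apply/orP; left; apply: imset_f; apply/F1F/F2F1.
have dY f : f \in F2 -> (l * r).+1 < #|[set h in F2 | Y h == Y f]|.
  move=> fF2; have -> : [set h in F2 | Y h == Y f]
      = [set h in F2 | (X h == Y f) || (Y h == Y f)].
    apply/setP=> h; rewrite !inE; apply: andb_id2l => hF2.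
    case: (eqVneq (X h) (Y f)); rewrite ?orbF // => YX.
    by have := cY f (F2F1 f fF2); rewrite -YX cX ?F2F1.
  apply: (deg _ f) => //; last by rewrite eqxx orbT.
  by rewrite inE; apply/orP; right; apply: imset_f; apply/F1F/F2F1.
have [f0 f0F2] := set0Pn _ F20.
(* Edges sharing an end decode the same data, so [F3] is a union of connected parts of [F2] and
   keeps its degrees. At a common [Y]-end only the length of [Q'] is shared; the fixed difference
   [d] carries this over to [Q]. *)
pose F3 := [set f in F2 | (v f == v f0) && (size (Q f) == size (Q f0))].
have F3F2 f : f \in F3 -> f \in F2 by rewrite inE => /andP[].
have F3v f : f \in F3 -> v f = v f0 /\ size (Q f) = size (Q f0).
  by rewrite inE => /and3P[_ /eqP-> /eqP->].
have F3X f : f \in F3 -> [set h in F3 | X h == X f] = [set h in F2 | X h == X f].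
  move=> fF3; have [vf sf] := F3v f fF3.
  apply/setP=> h; rewrite !inE; apply: andb_id2r => /eqP hX1.
  case: (boolP (h \in F2)) => //= hF2.
  have := qXE _ (F2F1 _ hF2); rewrite hX1 qXE ?F2F1 ?F3F2 // => -[<- <-].
  by rewrite vf sf !eqxx.
have F3Y f : f \in F3 -> [set h in F3 | Y h == Y f] = [set h in F2 | Y h == Y f].
  move=> fF3; have [vf sf] := F3v f fF3.
  apply/setP=> h; rewrite !inE; apply: andb_id2r => /eqP hY1.
  case: (boolP (h \in F2)) => //= hF2.
  have := qYE _ (F2F1 _ hF2); rewrite hY1 qYE ?F2F1 ?F3F2 // => -[<- qq].
  have [_ _ _ _ [s1 _ _]] := ht h (F1F _ (F2F1 _ hF2)).
  have [_ _ _ _ [s2 _ _]] := ht f (F1F _ (F2F1 _ (F3F2 _ fF3))).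
  have : size (Q h) + d = size (Q f) + d by rewrite -s1 -s2 qq.
  by move/addIn => ->; rewrite vf sf !eqxx.
have f0F3 : f0 \in F3 by rewrite inE f0F2 !eqxx.
have F3F1 f : f \in F3 -> f \in F1 by move=> /F3F2/F2F1.
have [_ _ [p0 _ _ _ [I0 _]] _ [sz0 ltl odd_m]] := ht f0 (F1F _ (F3F1 _ f0F3)).
(* The number of edges missing from the cycle; as it is odd, a greedy path from an [X]-end stops at
   a [Y]-end. *)
set m := l - _ in odd_m.
have F3E : F3 \subset E by apply/subsetP=> f fF3; apply/(subsetP FE)/F1F/F3F1.
have [||||fs [f1 [pfs f1F3 szfs allfs]]] :=
    @greedy_lpath _ _ _ uE lE F3 X Y (l * r).+1 f0 m F3E f0F3.
- move=> f fF3; have [] := ht f (F1F _ (F3F1 _ fF3)) => _ _ _ nXY _.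
  by rewrite (hX f (F3F1 _ fF3)).1 (hY f (F3F1 _ fF3)).1.
- by move=> f fF3; rewrite F3X //; apply/dX/F3F2.
- by move=> f fF3; rewrite F3Y //; apply/dY/F3F2.
- by rewrite ltnS leq_mul2r leq_subr orbT.
rewrite odd_m in pfs.
have [v1 s1] := F3v _ f1F3.
have [_ _ [_ p1 _ nvf1 _] _ [sz1 _ _]] := ht f1 (F1F _ (F3F1 _ f1F3)).
rewrite v1 in p1 nvf1.
have kfs b : b \in pverts (X f0) fs -> [/\ b != v f0 & kc b <= 2].
  rewrite !inE => /orP[/eqP->|].
    have X0 := (hX f0 (F3F1 _ f0F3)).1.
    by rewrite (hv f0) ?F3F1 //; case: (kf f0 (X f0) (F3F1 _ f0F3) X0).
  rewrite bigcup_seq => /bigcupP[f ffs bf].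
  have fF3 : f \in F3 := allP allfs f ffs.
  have [<- _] := F3v _ fF3.
  by rewrite (hv f) ?F3F1 //; case: (kf f b (F3F1 _ fF3) bf).
have kX b f : f \in F3 -> b \in pverts (v f0) (Q f) -> b \in pverts (X f0) fs -> b = X f.
  move=> fF3 bQ /kfs[nbv kb]; have [vf _] := F3v _ fF3; rewrite -vf in bQ.
  case: (kQ f b (F3F1 _ fF3) bQ) => // [bv|k3]; last by rewrite k3 in kb.
  by rewrite bv vf eqxx in nbv.
have kY b f : f \in F3 -> b \in pverts (v f0) (Q' f) -> b \in pverts (X f0) fs -> b = Y f.
  move=> fF3 bQ /kfs[nbv kb]; have [vf _] := F3v _ fF3; rewrite -vf in bQ.
  case: (kQ' f b (F3F1 _ fF3) bQ) => // [bv|k3]; last by rewrite k3 in kb.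
  by rewrite bv vf eqxx in nbv.
have pcat : lpath E (v f0) (Q f0 ++ fs) (Y f1).
  apply: lpath_cat p0 pfs _; apply: setI_eq1; rewrite ?pverts_start //.
    exact: (hX f0 (F3F1 _ f0F3)).2.
  by move=> b b1 b2; apply: kX.
have Y1 := (hY f1 (F3F1 _ f1F3)).1.
apply: (lpaths_contain_cycle r2 _ uE _ pcat p1).
- exact: leq_ltn_trans (leq0n _) ltl.
- by apply: contraNneq nvf1 => ->.
- by rewrite size_cat szfs sz1 s1 -sz0 /m addnAC subnKC // ltnW.
rewrite (pverts_cat _ (lpath_end p0)); apply/setP=> b; rewrite !inE -!in_setU1.
rewrite -/(pverts (v f0) (Q f0)) -/(pverts (X f0) fs) -/(pverts (v f0) (Q' f1)).
apply/andP/orP => [[/orP[b1|b1] b2]|].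
(* These two paths may belong to different crossing edges, so only colours separate them: apart from
   [v f0], one carries classes 0 and 3, the other 1 and 4. *)
- left; move: b2; rewrite -v1 => b2.
  case: (kQ' f1 b (F3F1 _ f1F3) b2) => [->|bE|k4]; rewrite ?v1 ?eqxx //.
  + case: (kQ f0 b (F3F1 _ f0F3) b1) => [->|bE'|k3]; rewrite ?eqxx //.
    * by have := cX f0 (F3F1 _ f0F3); rewrite -bE' bE cY ?F3F1.
    * by move: k3; rewrite /kc bE cY ?F3F1.
  + case: (kQ f0 b (F3F1 _ f0F3) b1) => [->|bE'|k3]; rewrite ?eqxx //.
    * by move: k4; rewrite /kc bE' cX ?F3F1.
    * by rewrite k3 in k4.
- by right; apply/eqP; apply: (kY b f1).
- case=> [/eqP->|/eqP->]; first by rewrite !pverts_start.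
  by rewrite (lpath_end pfs) orbT (lpath_end p1).
Qed.

End CrossingPaths.

(** * Graded paths *)

Section GradedPaths.

Variables (V : finType) (E : {set {set V}}).

Implicit Types (u v w x y z : V) (e f g h : {set V}) (es : seq {set V}).
Implicit Types (pos : V -> nat) (c i : nat).

(* If the first edge has index [c], then the edge of index [m] has exactly one
   vertex of position at least 2 * (m + 1), the joint to the next edge; this is
   what forces common vertices of two graded paths onto edges of equal index. *)
Fixpoint gpath pos c v es u : Prop :=
  if es is e :: t then
    exists w, [/\ e \in E, v \in e, w \in e /\ v != w,
      forall z, z \in e -> z != w -> c.*2 <= pos z <= c.*2.+1
      & gpath pos c.+1 w t u]
  else v = u /\ pos v = c.*2.

Lemma gpath_ge pos c v es u z :
  gpath pos c v es u -> z \in pverts v es -> c.*2 <= pos z.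
Proof.
elim: es c v => [|e t IH] c v /=.
  by case=> _ pv; rewrite pverts0 inE => /eqP->; rewrite pv.
case=> w [_ ve [we _] pe pw]; rewrite (pverts_cons t ve we) => /setUP[ze|zw].
  case: (eqVneq z w) => [zw|nzw]; last by case/andP: (pe z ze nzw).
  by have := IH _ _ pw; rewrite zw => /(_ (pverts_start w t)); rewrite doubleS; lia.
by have := IH _ _ pw zw; rewrite doubleS; lia.
Qed.

(** Positions on the tail are at least [c.+1.*2], which only [w] may reach on [e]. The tail need not
    start at [w], so the lemma also separates [e] from the later edges of another path. *)
Lemma gpath_edge_tail pos c v w e t u z :
  (forall z, z \in e -> z != w -> c.*2 <= pos z <= c.*2.+1) ->
  gpath pos c.+1 v t u -> z \in e -> z \in pverts v t -> z = w.
Proof.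
move=> pe pw ze zt; apply/eqP; apply: contraT => /(pe z ze).
by have := gpath_ge pw zt; rewrite doubleS; lia.
Qed.

Lemma gpath_lpath pos c v es u : gpath pos c v es u -> lpath E v es u.
Proof.
elim: es c v => [|e t IH] c v /=; first by case.
case=> w [eE ve [we nvw] pe pw]; exists w; split=> //; last exact: IH pw.
apply: setI_eq1; rewrite ?pverts_start // => z ze zt.
exact: gpath_edge_tail pe pw ze zt.
Qed.

Lemma gpath_pos_end pos c v es u :
  gpath pos c v es u -> pos u = (c + size es).*2.
Proof.
elim: es c v => [|e t IH] c v /=; first by rewrite addn0 => -[<-].
by case=> w [_ _ _ _ /IH]; rewrite addSnnS.
Qed.

Lemma gpath_end_uniq pos c v es u z : gpath pos c v es u ->
  z \in pverts v es -> (c + size es).*2 <= pos z -> z = u.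
Proof.
elim: es c v => [|e t IH] c v /=.
  by case=> -> _; rewrite pverts0 inE => /eqP.
case=> w [_ ve [we _] pe pw]; rewrite (pverts_cons t ve we) => /setUP[ze|zw] le.
  case: (eqVneq z w) => [zw|nzw].
    by apply: IH pw _ _; rewrite ?zw ?pverts_start // addSnnS -zw.
  by have := pe z ze nzw; move: le; rewrite !doubleD doubleS; lia.
by apply: IH pw zw _; rewrite addSnnS.
Qed.

Lemma gpath_ext pos pos' c v es u :
  (forall z, z \in pverts v es -> pos' z = pos z) ->
  gpath pos c v es u -> gpath pos' c v es u.
Proof.
elim: es c v => [|e t IH] c v h /=.
  by case=> <- pv; rewrite h ?pverts_start.
case=> w [eE ve [we nvw] pe pw]; rewrite (pverts_cons t ve we) in h.
exists w; split=> //.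
  by move=> z ze nzw; rewrite h ?inE ?ze //; apply: pe.
by apply: IH pw => z zt; apply: h; apply/setUP; right.
Qed.

Lemma gpath_rcons pos c v es u f w : gpath pos c v es u ->
  f \in E -> u \in f -> w \in f -> u != w -> pos w = (c + size es).+1.*2 ->
  (forall z, z \in f -> z != w ->
    (c + size es).*2 <= pos z <= (c + size es).*2.+1) ->
  gpath pos c v (rcons es f) w.
Proof.
move=> + fE uf wf nuw; elim: es c v => [|e t IH] c v /=.
  by case=> -> _; rewrite addn0 => pw pf; exists w; split.
case=> w0 [eE ve we pe pw]; rewrite -addSnnS => pw' pf.
by exists w0; split=> //; apply: IH.
Qed.

Hypothesis lE : linear_hypergraph E.

(* The two paths are cut at the last edges where they meet: grading forces a
   common vertex to lie on edges with the same index, and linearity makes it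
   the only common vertex of these two edges. *)
Lemma gpath_meet pos c v v' es es' u u' :
  gpath pos c v es u -> gpath pos c v' es' u' -> size es = size es' ->
  u != u' -> (exists2 z, z \in pverts v es & z \in pverts v' es') ->
  exists y j, [/\ j < size es, y \in pverts v es /\ y \in pverts v' es',
    lpath E y (drop j es) u, lpath E y (drop j es') u'
    & pverts y (drop j es) :&: pverts y (drop j es') = [set y]].
Proof.
elim: es es' c v v' => [|e t IH] [|e' t'] c v v' //=.
  case=> -> _ [-> _] _ /eqP nuu [z].
  by rewrite !pverts0 !inE => /eqP-> /eqP.
case=> w [eE ve [we nvw] pe pw] [w' [e'E ve' [we' nvw'] pe' pw']] [sz] nuu ex.
case: (boolP [exists z, (z \in pverts w t) && (z \in pverts w' t')]).
  case/existsP=> z /andP[z1 z2].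
  have [|y [j [lt [y1 y2] p1 p2 I]]] := IH t' c.+1 w w' pw pw' sz nuu.
    by exists z.
  exists y, j.+1; split=> //; rewrite (pverts_cons t ve we) (pverts_cons t' ve' we').
  by rewrite !(inE, y1, y2) !orbT.
move=> /existsPn none.
have notboth z : z \in pverts w t -> z \in pverts w' t' -> False.
  by move=> z1 z2; have := none z; rewrite z1 z2.
have tail1 z : z \in e -> z \in pverts w' t' -> False.
  move=> z1 z2; have zw := gpath_edge_tail pe pw' z1 z2.
  by apply: (notboth z) => //; rewrite zw pverts_start.
have tail2 z : z \in e' -> z \in pverts w t -> False.
  move=> z1 z2; have zw := gpath_edge_tail pe' pw z1 z2.
  by apply: (notboth z) => //; rewrite zw pverts_start.
(* A common edge would contain [w'], which is on the second tail. *)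
have nee : e != e'.
  by apply/eqP=> ee; apply: (tail1 w'); rewrite ?ee ?pverts_start.
case: ex => y; rewrite (pverts_cons t ve we) (pverts_cons t' ve' we').
move=> /setUP[ye|yt] /setUP[ye'|yt'].
- have Iee := linear_edge_setI lE eE e'E nee ye ye'.
  exists y, 0; rewrite !drop0; split=> //.
  + by split; apply/setUP; left.
  + exists w; split=> //; last exact: gpath_lpath pw.
      by apply/eqP=> yw; apply: (tail2 y); rewrite ?yw ?pverts_start // -yw.
    apply: setI_eq1; rewrite ?pverts_start // => z; exact: gpath_edge_tail pe pw.
  + exists w'; split=> //; last exact: gpath_lpath pw'.
      by apply/eqP=> yw; apply: (tail1 y); rewrite ?yw ?pverts_start // -yw.
    apply: setI_eq1; rewrite ?pverts_start // => z; exact: gpath_edge_tail pe' pw'.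
  + rewrite (pverts_cons t ye we) (pverts_cons t' ye' we').
    apply: setI_eq1; [by apply/setUP; left | by apply/setUP; left |].
    move=> z /setUP[z1|z1] /setUP[z2|z2].
    * exact: setI_eq1P Iee z1 z2.
    * by case: (tail1 z).
    * by case: (tail2 z).
    * by case: (notboth z).
- by case: (tail1 y).
- by case: (tail2 y).
- by case: (notboth y).
Qed.

Lemma pverts_drop v y es j : y \in pverts v es ->
  pverts y (drop j es) \subset pverts v es.
Proof.
move=> yv; apply/subsetP=> z /setU1P[->//|]; rewrite bigcup_seq.
case/bigcupP=> e /mem_drop ees ze; apply/setU1P; right.
by rewrite bigcup_seq; apply/bigcupP; exists e.
Qed.

(** Here [P u] is the chosen path to [u] in the level [L], [F] is a set of retained edges leaving
    the level, and [O] covers the paths that they extend. *)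
Variables (x : V) (pos : V -> nat) (i : nat) (L : {set V}).
Variables (P : V -> seq {set V}) (F : {set {set V}}).
Variables (U : {set V} -> V) (O : {set V}).

Hypothesis hL : forall u, u \in L -> gpath pos 0 x (P u) u /\ size (P u) = i.
Hypothesis hF : forall f, f \in F ->
  [/\ f \in E, U f \in L, f :&: O = [set U f] & pverts x (P (U f)) \subset O].

(** Both ends have position [i.*2], which a graded path of [i] edges reaches only at its own end. *)
Lemma endpoint_in_path f g : f \in F -> g \in F ->
  U f \in pverts x (P (U g)) -> U f = U g.
Proof.
move=> /hF[_ UfL _ _] /hF[_ UgL _ _] h.
have [pf sf] := hL UfL; have [pg sg] := hL UgL.
by apply: (gpath_end_uniq pg h); rewrite sg (gpath_pos_end pf) sf.
Qed.

Lemma edge_setI_suffix f g y j : f \in F -> g \in F ->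
  y \in pverts x (P (U g)) ->
  forall z, z \in f -> z \in pverts y (drop j (P (U g))) -> z = U f /\ U f = U g.
Proof.
move=> fF gF yP z zf zd.
have [_ _ fO _] := hF fF; have [_ _ _ gO] := hF gF.
have zP := subsetP (pverts_drop j yP) z zd.
have zU := setI_eq1P fO zf (subsetP gO z zP).
by split=> //; apply: endpoint_in_path => //; rewrite -zU.
Qed.

Lemma suffix_rcons g w y j : g \in F -> w \in g -> w \notin O ->
  y \in pverts x (P (U g)) -> lpath E y (drop j (P (U g))) (U g) ->
  lpath E y (rcons (drop j (P (U g))) g) w /\
  pverts y (rcons (drop j (P (U g))) g) = pverts y (drop j (P (U g))) :|: g.
Proof.
move=> gF wg wO yP py; have [gE UgL gO gP] := hF gF.
have [Ugg UgO] := setI_eq1_in gO; have Uend := lpath_end py; split.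
  apply: (lpath_rcons py gE wg); first by apply: contraNneq wO => <-.
  apply: setI_eq1 => // z z1 z2.
  by case: (edge_setI_suffix gF gF yP z2 z1).
exact: pverts_rcons Uend Ugg.
Qed.

Lemma paths_meet g h : g \in F -> h \in F -> U g != U h ->
  exists y j, [/\ j < i, y \in pverts x (P (U g)) /\ y \in pverts x (P (U h)),
    lpath E y (drop j (P (U g))) (U g), lpath E y (drop j (P (U h))) (U h)
    & pverts y (drop j (P (U g))) :&: pverts y (drop j (P (U h))) = [set y]].
Proof.
move=> /hF[_ UgL _ _] /hF[_ UhL _ _] nU.
have [pg sg] := hL UgL; have [ph sh] := hL UhL.
rewrite -{1}sg; apply: gpath_meet pg ph _ nU _; first by rewrite sg sh.
by exists x; rewrite pverts_start.
Qed.

(** The second edge [g] at [w] supplies the other path. Linearity gives [U f != U g], so the chosen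
    paths can be cut at their last meeting; appending [g] makes the second leg one edge longer. *)
Lemma cross_endpoint_joint f g w : f \in F -> g \in F -> f != g ->
  w \in f -> w \in g -> w \notin O ->
  exists y j, [/\ j < i, y \in pverts x (P (U f)) /\ y \in pverts x (P (U g))
    & crosses E f (U f) w y (drop j (P (U f))) (rcons (drop j (P (U g))) g)].
Proof.
move=> fF gF nfg wf wg wO; have [fE _ fO fP] := hF fF; have [gE _ gO gP] := hF gF.
have [Uff _] := setI_eq1_in fO; have [Ugg _] := setI_eq1_in gO.
have nU : U f != U g.
  apply: contraNneq nfg => UU; apply/eqP.
  apply: (@linear_edge_eq _ _ lE _ _ (U f) w) => //; last by rewrite UU.
  by apply: contraNneq wO => <-; case/setI_eq1_in: fO.
have [y [j [lt [y1 y2] p1 p2 I]]] := paths_meet fF gF nU.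
have [p2' E2] := suffix_rcons gF wg wO y2 p2.
exists y, j; split=> //; split=> //.
- rewrite E2; apply: setI_eq1; rewrite ?pverts_start ?inE ?eqxx //.
  move=> z z1 /setUP[z2|z2]; first exact: setI_eq1P I z1 z2.
  have [_ UU] := edge_setI_suffix gF fF y1 z2 z1.
  by rewrite UU eqxx in nU.
- apply/negP=> yf.
  have [_ UU] := edge_setI_suffix fF gF y2 yf (pverts_start y (drop j (P (U g)))).
  by rewrite UU eqxx in nU.
- split.
    apply: setI_eq1 => //; [exact: lpath_end p1 | move=> z z1 z2].
    by case: (edge_setI_suffix fF fF y1 z1 z2).
  rewrite E2; apply: setI_eq1 => //; [by apply/setUP; right | move=> z z1].
  case/setUP=> [z2|z2].
    have [_ UU] := edge_setI_suffix fF gF y2 z1 z2.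
    by rewrite UU eqxx in nU.
  exact: setI_eq1P (linear_edge_setI lE fE gE nfg wf wg) z1 z2.
Qed.

(** Both legs end with an appended edge, [g] at [w] and [h] at [s]. If these edges meet, they are
    the legs; otherwise [U g != U h] and [paths_meet] supplies the rest. *)
Lemma cross_joint_joint f g h w s : f \in F -> g \in F -> h \in F ->
  f != g -> f != h -> w != s -> w \in f -> w \in g -> w \notin O ->
  s \in f -> s \in h -> s \notin O ->
  exists y j, [/\ j <= i,
    y \in pverts x (rcons (P (U g)) g) /\ y \in pverts x (rcons (P (U h)) h)
    & crosses E f w s y (rcons (drop j (P (U g))) g)
        (rcons (drop j (P (U h))) h)].
Proof.
move=> fF gF hF' nfg nfh nws wf wg wO sf sh sO.
have [fE _ fO fP] := hF fF; have [gE gL gO gP] := hF gF; have [hE hhL hO hP] := hF hF'.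
have [Uff UfO] := setI_eq1_in fO; have [Ugg _] := setI_eq1_in gO.
have [Uhh _] := setI_eq1_in hO.
have Ifg := linear_edge_setI lE fE gE nfg wf wg.
have Ifh := linear_edge_setI lE fE hE nfh sf sh.
have Ug : U f != U g.
  apply/eqP=> UU; have Ufg : U f \in g by rewrite UU.
  by case/negP: wO; rewrite -(setI_eq1P Ifg Uff Ufg).
have Uh : U f != U h.
  apply/eqP=> UU; have Ufh : U f \in h by rewrite UU.
  by case/negP: sO; rewrite -(setI_eq1P Ifh Uff Ufh).
have wh : w \notin h by apply: contra nws => wh; rewrite (setI_eq1P Ifh wf wh).
have sg : s \notin g by apply: contra nws => sg; rewrite (setI_eq1P Ifg sf sg).
have xend u : u \in L -> u \in pverts x (P u).
  by move=> /hL[p _]; exact: lpath_end (gpath_lpath p).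
have pR k : k \in F -> pverts x (rcons (P (U k)) k) = pverts x (P (U k)) :|: k.
  move=> kF; have [_ kL kO _] := hF kF.
  by apply: pverts_rcons (xend _ kL) _; case/setI_eq1_in: kO.
case: (boolP [exists y, (y \in g) && (y \in h)]).
  (* The index [i] drops the whole of each chosen path and leaves only the appended edge. *)
  case/existsP=> y /andP[yg yh]; exists y, i.
  have [_ szg] := hL gL; have [_ szh] := hL hhL.
  have dg : drop i (P (U g)) = [::] by rewrite -szg drop_size.
  have dh : drop i (P (U h)) = [::] by rewrite -szh drop_size.
  rewrite (pR g) // (pR h) // dg dh /=.
  rewrite ![y \in _ :|: _]in_setU yg yh !orbT; split=> //.
  have ngh : g != h by apply: contraNneq sg => ->.
  have Igh := linear_edge_setI lE gE hE ngh yg yh.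
  have yw : y != w by apply: contraNneq wh => <-.
  have ys : y != s by apply: contraNneq sg => <-.
  have pg : pverts y [:: g] = g.
    by rewrite (pverts_cons _ yg yg) pverts0; apply/setUidPl; rewrite sub1set.
  have ph : pverts y [:: h] = h.
    by rewrite (pverts_cons _ yh yh) pverts0; apply/setUidPl; rewrite sub1set.
  split; rewrite ?pg ?ph //; [exact: lpath1 | exact: lpath1 |].
  by apply: contra yw => yf; rewrite (setI_eq1P Ifg yf yg).
move=> /existsPn none.
have ngh z : z \in g -> z \in h -> False.
  by move=> z1 z2; have := none z; rewrite z1 z2.
have nU : U g != U h by apply/eqP=> UU; apply: (ngh (U g)); rewrite // UU.
have [y [j [lt [y1 y2] p1 p2 I]]] := paths_meet gF hF' nU.
have [p1' E1] := suffix_rcons gF wg wO y1 p1.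
have [p2' E2] := suffix_rcons hF' sh sO y2 p2.
exists y, j; rewrite (ltnW lt) (pR g) // (pR h) //; split=> //.
  by split; apply/setUP; left.
split=> //; rewrite ?E1 ?E2.
- apply: setI_eq1; rewrite ?inE ?eqxx // => z /setUP[z1|z1] /setUP[z2|z2].
  + exact: setI_eq1P I z1 z2.
  + have [_ UU] := edge_setI_suffix hF' gF y1 z2 z1.
    by rewrite UU eqxx in nU.
  + have [_ UU] := edge_setI_suffix gF hF' y2 z1 z2.
    by rewrite UU eqxx in nU.
  + by case: (ngh z).
- apply/negP=> yf.
  have [_ UU] := edge_setI_suffix fF gF y1 yf (pverts_start y (drop j (P (U g)))).
  by rewrite UU eqxx in Ug.
- split; apply: setI_eq1 => //; try by [apply/setUP; right].
    move=> z z1 /setUP[z2|z2]; last exact: setI_eq1P Ifg z1 z2.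
    have [_ UU] := edge_setI_suffix fF gF y1 z1 z2.
    by rewrite UU eqxx in Ug.
  move=> z z1 /setUP[z2|z2]; last exact: setI_eq1P Ifh z1 z2.
  have [_ UU] := edge_setI_suffix fF hF' y2 z1 z2.
  by rewrite UU eqxx in Uh.
Qed.

End GradedPaths.

(** * Growth of the levels *)

Section Levels.

Variables (V : finType) (E : {set {set V}}) (r l D : nat).
Hypotheses (r3 : 3 <= r) (uE : uniform r E) (lE : linear_hypergraph E).
Hypothesis degE :
  forall z e, e \in E -> z \in e -> D < #|[set e in E | z \in e]|.

Implicit Types (u v w x y z : V) (e f g h : {set V}) (es : seq {set V}).

Definition pick_in x (S : {set V}) : V := odflt x [pick z in S].

Lemma pick_in1 x z : pick_in x [set z] = z.
Proof.
by rewrite /pick_in; case: pickP => [y|/(_ z)]; rewrite inE ?eqxx // => /eqP.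
Qed.

(** By [card_edges_meeting], all but [(l * r).+1] of the edges at [u] meet [P u] only in [u]. A
    random colouring with four colours, for path vertices, two marked vertices and the rest, is
    prescribed on at most [r + (l * r).+1] vertices per edge; [O], [CW] and [CS] are colour classes
    common to all retained edges. *)
Lemma exists_colored_extensions x pos i (L : {set V}) (P : V -> seq {set V}) :
  i < l ->
  (forall u, u \in L -> gpath E pos 0 x (P u) u /\ size (P u) = i) ->
  (forall u, u \in L -> exists2 e, e \in E & u \in e) ->
  exists (F : {set {set V}}) (O CW CS : {set V}) (U W S : {set V} -> V),
  [/\ (D - (l * r).+1) * #|L| <= #|F| * 4 ^ (r + (l * r).+1),
     forall f, f \in F ->
       [/\ f \in E, U f \in L, f :&: O = [set U f] & pverts x (P (U f)) \subset O],
     forall f, f \in F -> f :&: CW = [set W f],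
     forall f, f \in F -> f :&: CS = [set S f]
   & [/\ [disjoint CW & O], [disjoint CS & O] & [disjoint CW & CS]]].
Proof.
move=> il hL hE.
pose A := [set a : V * {set V} | [&& a.1 \in L, a.2 \in E, a.1 \in a.2
  & pverts x (P a.1) :&: a.2 \subset [set a.1]]].
have szP u : u \in L -> #|pverts x (P u)| <= (l * r).+1.
  move=> /hL[p sz]; apply: leq_trans (card_pverts uE x (lpath_all (gpath_lpath p))) _.
  by rewrite sz ltnS leq_mul2r ltnW ?orbT.
have AP a : a \in A -> [/\ a.1 \in L, a.2 \in E, a.1 \in a.2
    & forall z, z \in pverts x (P a.1) -> z \in a.2 -> z = a.1].
  rewrite inE => /and4P[h1 h2 h3 /subsetP h4]; split=> // z z1 z2.
  by apply/eqP; rewrite -in_set1; apply: h4; rewrite inE z1.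
have cA : (D - (l * r).+1) * #|L| <= #|A|.
  have -> : #|A| = \sum_(u in L) \sum_(e | (u, e) \in A) 1.
    rewrite pair_big_dep /= -sum1_card; apply: eq_bigl => -[u e] /=.
    by rewrite inE /=; case: (u \in L).
  rewrite mulnC -sum_nat_const; apply: leq_sum => u uL.
  have [e eE ue] := hE u uL; have lt := degE eE ue.
  have c1 := card_edges_meeting lE (pverts x (P u)) u; have c2 := szP u uL.
  rewrite sum1dep_card.
  suff : [set e in E | u \in e] \subset
    [set e in E | (u \in e) && ~~ (pverts x (P u) :&: e \subset [set u])]
      :|: [set e | (u, e) \in A].
    move/subset_leq_card; have := leq_card_setU
      [set e in E | (u \in e) && ~~ (pverts x (P u) :&: e \subset [set u])]
      [set e | (u, e) \in A] => -[h1 _] h2.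
    by rewrite leq_subLR; apply: leq_trans (leq_add (leq_trans c1 c2) (leqnn _));
      apply: leq_trans h1; apply: leq_trans h2; exact: ltnW.
  apply/subsetP=> f; rewrite !inE /= uL => /andP[-> ->] /=.
  by rewrite orNb.
have [ws hws] : exists ws : V * {set V} -> V * V, forall a, a \in A ->
    [/\ (ws a).1 \in a.2, (ws a).2 \in a.2, (ws a).1 != a.1, (ws a).2 != a.1
      & (ws a).1 != (ws a).2].
  apply: (fin_all_exists (P := fun a ws => a \in A -> [/\ ws.1 \in a.2,
    ws.2 \in a.2, ws.1 != a.1, ws.2 != a.1 & ws.1 != ws.2])) => a.
  case: (boolP (a \in A)) => [/AP[_ aE a12 _]|_]; last by exists (x, x).
  have ca : #|a.2| = r := eqP (forall_inP uE _ aE).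
  have /card_gt1P[w [s [w1 s1 nws]]] : 1 < #|a.2 :\ a.1|.
    by have := cardsD1 a.1 a.2; rewrite a12 ca; clear -r3; lia.
  by exists (w, s); move: w1 s1; rewrite !inE => /andP[-> ->] /andP[-> ->].
pose g (a : V * {set V}) z : 'I_4 := if z \in pverts x (P a.1) then inord 0
  else if z == (ws a).1 then inord 1 else if z == (ws a).2 then inord 2
  else inord 3.
have [||c hc] := @exists_coloring V _ 'I_4 A
    (fun a => a.2 :|: pverts x (P a.1)) g (r + (l * r).+1).
- by rewrite card_ord.
- move=> a /AP[aL aE _ _]; rewrite (leq_trans (leq_card_setU _ _)) //.
  by rewrite leq_add ?szP // (eqP (forall_inP uE _ aE)).
rewrite card_ord in hc; set A1 := [set a in A | _] in hc.
have A1A a : a \in A1 -> a \in A by rewrite inE => /andP[].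
have cg a z : a \in A1 -> z \in a.2 :|: pverts x (P a.1) -> c z = g a z.
  by rewrite inE => /andP[_ /forall_inP h] /h/eqP.
pose cl k := [set z | val (c z) == k].
have xend u : u \in L -> u \in pverts x (P u).
  by move=> /hL[p _]; exact: lpath_end (gpath_lpath p).
have cl0 a : a \in A1 -> pverts x (P a.1) \subset cl 0.
  move=> aA1; apply/subsetP=> z zP; rewrite inE (cg a) //; last by apply/setUP; right.
  by rewrite /g zP /= inordK.
have a0 a : a \in A1 -> a.2 :&: cl 0 = [set a.1].
  move=> aA1; have [aL aE a12 aI] := AP a (A1A a aA1).
  apply: setI_eq1 => //; first by apply: (subsetP (cl0 a aA1)); apply: xend.
  move=> z z1; rewrite inE (cg a) //; last by apply/setUP; left.
  rewrite /g; case: (boolP (z \in pverts _ _)) => [zP _|_]; first exact: aI.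
  by case: ifP => _; last case: ifP => _; rewrite /= inordK.
have aO a z : a \in A1 -> z \in a.2 -> z != a.1 -> z \notin pverts x (P a.1).
  by move=> /A1A/AP[_ _ _ aI] za; apply: contra => zP; rewrite (aI z).
have a1 a : a \in A1 -> a.2 :&: cl 1 = [set (ws a).1].
  move=> aA1; have [w2 s2 nw ns nws] := hws a (A1A a aA1).
  apply: setI_eq1 => //.
    rewrite inE (cg a) //; last by apply/setUP; left.
    by rewrite /g (negbTE (aO a _ aA1 w2 nw)) eqxx /= inordK.
  move=> z z1; rewrite inE (cg a) //; last by apply/setUP; left.
  rewrite /g; case: ifP => _; first by rewrite /= inordK.
  by case: (eqVneq z (ws a).1) => // _; case: ifP => _; rewrite /= inordK.
have a2 a : a \in A1 -> a.2 :&: cl 2 = [set (ws a).2].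
  move=> aA1; have [w2 s2 nw ns nws] := hws a (A1A a aA1).
  apply: setI_eq1 => //.
    rewrite inE (cg a) //; last by apply/setUP; left.
    by rewrite /g (negbTE (aO a _ aA1 s2 ns)) [_.2 == _.1]eq_sym (negbTE nws) eqxx /= inordK.
  move=> z z1; rewrite inE (cg a) //; last by apply/setUP; left.
  rewrite /g; case: ifP => _; first by rewrite /= inordK.
  case: ifP => _; first by rewrite /= inordK.
  by case: (eqVneq z (ws a).2) => // _; rewrite /= inordK.
have cl_dis j k : j != k -> [disjoint cl j & cl k].
  move=> njk; rewrite -setI_eq0; apply/eqP/setP=> z; rewrite !inE.
  by case: eqP => // ->; apply/negbTE.
(* The start and the marked vertices are the only ones of their colours on the edge, so pairs in
   [A1] are recovered from their edges and [U], [W], [S] become functions of the edge. *)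
exists (snd @: A1), (cl 0), (cl 1), (cl 2).
exists (fun f => pick_in x (f :&: cl 0)), (fun f => pick_in x (f :&: cl 1)),
  (fun f => pick_in x (f :&: cl 2)).
split.
- rewrite card_in_imset; first exact: leq_trans cA hc.
  move=> a b aA1 bA1 ab; rewrite [a]surjective_pairing [b]surjective_pairing ab.
  by congr (_, _); apply: set1_inj; rewrite -a0 // ab a0.
- move=> _ /imsetP[a aA1 ->]; have [aL aE _ _] := AP a (A1A a aA1).
  by rewrite a0 // pick_in1; split=> //; apply: cl0.
- by move=> _ /imsetP[a aA1 ->]; rewrite a1 // pick_in1.
- by move=> _ /imsetP[a aA1 ->]; rewrite a2 // pick_in1.
- by rewrite !cl_dis.
Qed.

(** The incident edge is recorded so that [degE] applies at [u]; for [i = 0] the empty path provides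
    none. *)
Definition is_level pos x i (L : {set V}) : Prop :=
  forall u, u \in L ->
    (exists2 es, gpath E pos 0 x es u & size es = i) /\
    (exists2 e, e \in E & u \in e).

Section Extend.

Variables (x : V) (pos : V -> nat) (i : nat) (L : {set V}).
Variables (P : V -> seq {set V}) (F : {set {set V}}).
Variables (U : {set V} -> V) (O : {set V}).

Hypothesis il : i < l.
Hypothesis hL : forall u, u \in L -> gpath E pos 0 x (P u) u /\ size (P u) = i.
Hypothesis hF : forall f, f \in F ->
  [/\ f \in E, U f \in L, f :&: O = [set U f] & pverts x (P (U f)) \subset O].

(** Positions are kept on [O], so old paths stay graded. Off [O], vertices of [C] get the position
    of the new end and all others the odd value just below; [f] has only [T f] in [C]. *)
Lemma is_level_extend (C : {set V}) (T : {set V} -> V) :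
  [disjoint C & O] -> (forall f, f \in F -> f :&: C = [set T f]) ->
  exists pos', is_level pos' x i.+1 (T @: F).
Proof.
move=> dCO hT.
exists (fun z => if z \in O then pos z else if z \in C then i.+1.*2 else i.*2.+1).
move=> _ /imsetP[f fF ->]; have [fE UL fO PO] := hF fF.
have [Uf UO] := setI_eq1_in fO; have [Tf TC] := setI_eq1_in (hT f fF).
have TO : T f \notin O by rewrite (disjointFr dCO TC).
have [p sz] := hL UL; split; last by exists f.
exists (rcons (P (U f)) f); last by rewrite size_rcons sz.
apply: (@gpath_rcons _ _ _ _ _ _ (U f)) => //.
- by apply: gpath_ext p => z /(subsetP PO) ->.
- by apply: contraNneq TO => <-.
- by rewrite (negbTE TO) TC sz.
move=> z zf nzT; rewrite add0n sz; case: (boolP (z \in O)) => zO.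
  by rewrite (setI_eq1P fO zf zO) (gpath_pos_end p) add0n sz leqnn leqnSn.
case: (boolP (z \in C)) => zC; last by rewrite leqnSn leqnn.
by rewrite (setI_eq1P (hT f fF) zf zC) eqxx in nzT.
Qed.

(** Chosen from the joint alone, this edge makes [T f] the end of a path avoiding the edge [f],
    unless [f] is its own representative. *)
Definition rep_edge (T : {set V} -> V) z : {set V} :=
  odflt set0 [pick f in F | T f == z].

Lemma rep_edgeP (T : {set V} -> V) f : f \in F ->
  rep_edge T (T f) \in F /\ T (rep_edge T (T f)) = T f.
Proof.
move=> fF; rewrite /rep_edge; case: pickP => [g /andP[-> /eqP]//|/(_ f)].
by rewrite fF eqxx.
Qed.

Lemma card_rep_edge (T : {set V} -> V) :
  #|[set f in F | f == rep_edge T (T f)]| <= #|T @: F|.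
Proof.
rewrite -(card_in_imset (f := T)).
  by apply/subset_leq_card/imsetS/subsetP=> f; rewrite inE => /andP[].
by move=> f g; rewrite !inE => /andP[_ /eqP fE] /andP[_ /eqP gE] h; rewrite fE gE h.
Qed.

(** Colours are decoded from the end alone, so the list runs over all pairs of a cut vertex and a
    cut index, whether or not they fit together. *)
Definition suffix_cands u : seq (V * seq {set V}) :=
  [seq (y, drop j (P u)) | y <- enum (pverts x (P u)), j <- iota 0 i.+1].

Definition extended_cands (T : {set V} -> V) z : seq (V * seq {set V}) :=
  let g := rep_edge T z in
  [seq (y, rcons (drop j (P (U g))) g) | y <- enum (pverts x (rcons (P (U g)) g)),
     j <- iota 0 i.+1].

Lemma size_suffix_cands u : u \in L -> size (suffix_cands u) <= (l * r).+1 * l.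
Proof.
move=> /hL[p sz]; rewrite size_allpairs -cardE size_iota leq_mul //.
apply: leq_trans (card_pverts uE x (lpath_all (gpath_lpath p))) _.
by rewrite sz ltnS leq_mul2r ltnW ?orbT.
Qed.

Lemma size_extended_cands T f :
  f \in F -> size (extended_cands T (T f)) <= (l * r).+1 * l.
Proof.
move=> fF; have [gF _] := rep_edgeP T fF; have [gE gL _ _] := hF gF.
have [p sz] := hL gL.
rewrite size_allpairs -cardE size_iota leq_mul //.
apply: leq_trans (card_pverts uE x _) _.
  by rewrite all_rcons /= gE (lpath_all (gpath_lpath p)).
by rewrite size_rcons sz ltnS leq_mul2r il orbT.
Qed.

Hypothesis noC : ~~ contains_copy (linear_cycle r l) E.

(** Edges representing their own joint are discarded. The others are crossed by legs of [i - j] and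
    [i - j + 1] edges, an odd total, so that an odd number is missing to the even [l]; too many of
    them would close a cycle, with [d = 1]. *)
Lemma card_extensions_even (C : {set V}) (W : {set V} -> V) :
  [disjoint C & O] -> (forall f, f \in F -> f :&: C = [set W f]) ->
  ~~ odd l -> i.*2.+1 < l ->
  #|F| <= (cross_const r l ((l * r).+1 * l)).+1 * (#|L| + #|W @: F|).
Proof.
set K := cross_const _ _ _ => dCO hW evl ltl.
pose F2 := [set f in F | f != rep_edge W (W f)].
have F2F : F2 \subset F by apply/subsetP=> f; rewrite inE => /andP[].
have cF : #|F| <= #|F2| + #|W @: F|.
  apply: leq_trans (leq_add (leqnn _) (card_rep_edge W)).
  apply: leq_trans (leq_card_setU _ _).
  by apply/subset_leq_card/subsetP=> f fF; rewrite !inE fF orNb.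
have cU : #|U @: F2| <= #|L|.
  apply/subset_leq_card/subsetP=> _ /imsetP[f /(subsetP F2F)/hF[_ UL _ _] ->] //.
have cW : #|W @: F2| <= #|W @: F| by apply/subset_leq_card/imsetS.
suff cF2 : #|F2| <= K * (#|U @: F2| + #|W @: F2|).
  apply: leq_trans cF _; rewrite mulSn addnC leq_add ?leq_addl //.
  by apply: leq_trans cF2 _; rewrite leq_mul2l leq_add ?orbT.
rewrite leqNgt; apply: contra noC => lt.
apply: (@crossing_paths_cycle r l _ V E _ uE lE F2 U W suffix_cands
  (extended_cands W) 1 _ _ _ _ lt).
- exact: ltnW.
- by apply: subset_trans F2F _; apply/subsetP=> f /hF[].
- by move=> f /(subsetP F2F)/hF[_ UL _ _]; exact: size_suffix_cands.
- by move=> f /(subsetP F2F); exact: size_extended_cands.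
move=> f; rewrite inE => /andP[fF]; set g := rep_edge _ _ => nfg.
have [gF Wg] := rep_edgeP W fF; rewrite -/g in gF Wg.
have [Wf WC] := setI_eq1_in (hW f fF).
have Wgg : W f \in g by rewrite -Wg; case/setI_eq1_in: (hW g gF).
have WO : W f \notin O by rewrite (disjointFr dCO WC).
have [y [j [lt1 [y1 y2] cr]]] := cross_endpoint_joint lE hL hF fF gF nfg Wf Wgg WO.
have [_ fL fO _] := hF fF; have [_ gL gO _] := hF gF.
have [_ sf] := hL fL; have [pg sg] := hL gL.
have jI : j \in iota 0 i.+1 by rewrite mem_iota add0n /= ltnS ltnW.
exists (y, drop j (P (U f)), rcons (drop j (P (U g))) g); split=> //.
- by apply: allpairs_f; rewrite ?mem_enum.
- rewrite /extended_cands -/g; apply: allpairs_f; rewrite ?mem_enum //.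
  rewrite (pverts_rcons (lpath_end (gpath_lpath pg))); last by case/setI_eq1_in: gO.
  by apply/setUP; left.
- by apply: contraNneq WO => <-; case/setI_eq1_in: fO.
- rewrite size_rcons !size_drop sf sg; have le2 : (i - j) + (i - j).+1 < l by clear -ltl; lia.
  split=> //; first by rewrite addn1.
  rewrite oddB; last exact: ltnW.
  by rewrite (negbTE evl) /= addnS /= addnn odd_double.
Qed.

(** Both ends of the crossing edge are joints, so both legs have [i - j + 1] edges; the even total
    suits odd [l], with [d = 0]. *)
Lemma card_extensions_odd (CW CS : {set V}) (W S : {set V} -> V) :
  [disjoint CW & O] -> [disjoint CS & O] -> [disjoint CW & CS] ->
  (forall f, f \in F -> f :&: CW = [set W f]) ->
  (forall f, f \in F -> f :&: CS = [set S f]) ->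
  odd l -> i.*2.+2 < l ->
  #|F| <= (cross_const r l ((l * r).+1 * l)).+1 * (#|W @: F| + #|S @: F|).
Proof.
set K := cross_const _ _ _ => dWO dSO dWS hW hS odl ltl.
pose F2 := [set f in F | (f != rep_edge W (W f)) && (f != rep_edge S (S f))].
have F2F : F2 \subset F by apply/subsetP=> f; rewrite inE => /andP[].
have cF : #|F| <= #|F2| + (#|W @: F| + #|S @: F|).
  apply: leq_trans (leq_add (leqnn _) (leq_add (card_rep_edge W) (card_rep_edge S))).
  apply: leq_trans (leq_add (leqnn _) (leq_card_setU _ _)).
  apply: leq_trans (leq_card_setU _ _).
  apply/subset_leq_card/subsetP=> f fF; rewrite !inE fF /=.
  by case: eqP; case: eqP.
have cW : #|W @: F2| <= #|W @: F| by apply/subset_leq_card/imsetS.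
have cS : #|S @: F2| <= #|S @: F| by apply/subset_leq_card/imsetS.
suff cF2 : #|F2| <= K * (#|W @: F2| + #|S @: F2|).
  apply: leq_trans cF _; rewrite mulSn addnC leq_add //.
  by apply: leq_trans cF2 _; rewrite leq_mul2l leq_add ?orbT.
rewrite leqNgt; apply: contra noC => lt.
apply: (@crossing_paths_cycle r l _ V E _ uE lE F2 W S (extended_cands W)
  (extended_cands S) 0 _ _ _ _ lt).
- exact: ltnW.
- by apply: subset_trans F2F _; apply/subsetP=> f /hF[].
- by move=> f /(subsetP F2F); exact: size_extended_cands.
- by move=> f /(subsetP F2F); exact: size_extended_cands.
move=> f; rewrite inE => /and3P[fF].
set g := rep_edge _ _; set h := rep_edge _ _ => nfg nfh.
have [gF Wg] := rep_edgeP W fF; rewrite -/g in gF Wg.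
have [hF' Sh] := rep_edgeP S fF; rewrite -/h in hF' Sh.
have [Wf WC] := setI_eq1_in (hW f fF); have [Sf SC] := setI_eq1_in (hS f fF).
have Wgg : W f \in g by rewrite -Wg; case/setI_eq1_in: (hW g gF).
have Shh : S f \in h by rewrite -Sh; case/setI_eq1_in: (hS h hF').
have WO : W f \notin O by rewrite (disjointFr dWO WC).
have SO : S f \notin O by rewrite (disjointFr dSO SC).
have nWS : W f != S f by apply/eqP=> WS; rewrite -WS (disjointFr dWS WC) in SC.
have [y [j [le1 [y1 y2] cr]]] :=
  cross_joint_joint lE hL hF fF gF hF' nfg nfh nWS Wf Wgg WO Sf Shh SO.
have [_ gL _ _] := hF gF; have [_ hhL _ _] := hF hF'.
have [_ sg] := hL gL; have [_ sh] := hL hhL.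
have jI : j \in iota 0 i.+1 by rewrite mem_iota add0n /= ltnS.
exists (y, rcons (drop j (P (U g))) g, rcons (drop j (P (U h))) h); split=> //.
- by rewrite /extended_cands -/g; apply: allpairs_f; rewrite ?mem_enum.
- by rewrite /extended_cands -/h; apply: allpairs_f; rewrite ?mem_enum.
- rewrite !size_rcons !size_drop sg sh; have le2 : (i - j).+1 + (i - j).+1 < l by clear -ltl; lia.
  split=> //; first by rewrite addn0.
  rewrite oddB; last exact: ltnW.
  by rewrite odl addnn odd_double.
Qed.

End Extend.

(** The first summand pays for edges running back into a path, the power of 4 for the colouring. The
    doubling lets the larger of two vertex sets stand for both when [l] is odd. *)
Definition growth_const : nat :=
  (l * r).+1 + 4 ^ (r + (l * r).+1) * (cross_const r l ((l * r).+1 * l)).+1.*2.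

Lemma exists_next_level x pos i (L : {set V}) :
  ~~ contains_copy (linear_cycle r l) E -> i < l./2 -> is_level pos x i L ->
  exists pos' (L' : {set V}), is_level pos' x i.+1 L' /\
    (D - growth_const) * #|L| <= growth_const * #|L'|.
Proof.
move=> noC il hlev.
have il' : i < l by clear -il; lia.
have [P hP] : exists P : V -> seq {set V},
    forall u, u \in L -> gpath E pos 0 x (P u) u /\ size (P u) = i.
  apply: (fin_all_exists
    (P := fun u es => u \in L -> gpath E pos 0 x es u /\ size es = i)) => u.
  case: (boolP (u \in L)) => [/hlev[[es p sz] _]|_]; [by exists es | by exists [::]].
have hE u : u \in L -> exists2 e, e \in E & u \in e by move=> /hlev[].
have [F [O [CW [CS [U [W [S [cF hF hW hS [dW dS dWS]]]]]]]]] :=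
  exists_colored_extensions il' hP hE.
have [posW levW] := is_level_extend hP hF dW hW.
have [posS levS] := is_level_extend hP hF dS hS.
(* The share of [#|L|] moves to the left side, which is why the constant is also subtracted from
   [D]. *)
have step (L' : {set V}) :
    #|F| <= (cross_const r l ((l * r).+1 * l)).+1.*2 * (#|L| + #|L'|) ->
    (D - growth_const) * #|L| <= growth_const * #|L'|.
  rewrite /growth_const; move: (4 ^ _) cF => a; move: (_.+1.*2) => b.
  move: ((l * r).+1) => c cF cF2.
  have : (D - c) * #|L| <= a * b * (#|L| + #|L'|).
    by apply: leq_trans cF _; rewrite mulnC -mulnA leq_mul2l cF2 orbT.
  rewrite subnDA mulnBl mulnDr; move: (a * b) => d; rewrite mulnDl; clear; lia.
case: (boolP (odd l)) => odl.
  have := card_extensions_odd il' hP hF noC dW dS dWS hW hS odl.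
  have -> : i.*2.+2 < l by clear -il odl; lia.
  move/(_ isT); set K := _.+1 => cF'.
  case: (leqP #|S @: F| #|W @: F|) => le; [exists posW, (W @: F) | exists posS, (S @: F)];
    split=> //; apply: step; apply: leq_trans cF' _; rewrite -/K -doubleMl doubleMr leq_mul2l; clear -le; lia.
exists posW, (W @: F); split=> //; apply: step.
have := card_extensions_even il' hP hF noC dW hW odl.
have -> : i.*2.+1 < l by clear -il odl; lia.
move/(_ isT) => cF'; apply: leq_trans cF' _.
by rewrite leq_mul2r -addnn leq_addl orbT.
Qed.

Lemma level_growth x e0 : ~~ contains_copy (linear_cycle r l) E ->
  e0 \in E -> x \in e0 ->
  (D - growth_const) ^ l./2 <= growth_const ^ l./2 * #|V|.
Proof.
move=> noC e0E xe0.
have key i : i <= l./2 -> exists pos (L : {set V}), is_level pos x i L /\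
    (D - growth_const) ^ i <= growth_const ^ i * #|L|.
  elim: i => [|i IH] le.
    exists (fun _ => 0), [set x]; split; last by rewrite cards1.
    by move=> _ /set1P ->; split; [exists [::] | exists e0].
  have [pos [L [lev cL]]] := IH (ltnW le).
  have [pos' [L' [lev' cL']]] := exists_next_level noC le lev.
  exists pos', L'; split=> //.
  rewrite !expnS -mulnA [leqRHS]mulnCA.
  apply: leq_trans (leq_mul (leqnn _) cL').
  by rewrite mulnCA leq_mul2l cL orbT.
have [pos [L [_ le]]] := key _ (leqnn _); apply: leq_trans le _.
by rewrite leq_mul2l max_card orbT.
Qed.

End Levels.

(** * From level growth to the bound on the number of edges *)

Lemma exL_growth (r l n D : nat) : 3 <= r -> 3 <= l ->
  D * n < exL r n (linear_cycle r l) ->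
  (D - growth_const r l) ^ l./2 <= growth_const r l ^ l./2 * n.
Proof.
move=> r3 l3; rewrite /exL.
rewrite ltnNge => /negP nle.
case: (boolP [exists E : {set {set 'I_n}}, [&& uniform r E, linear_hypergraph E,
    ~~ contains_copy (linear_cycle r l) E & D * n < #|E|]]); last first.
  move=> /existsPn none; case: nle; apply/bigmax_leqP => E /and3P[h1 h2 h3].
  by have := none E; rewrite h1 h2 h3 /= -leqNgt.
case/existsP=> E /and4P[uE lE noC DE].
have [|E' [E'E E'0 deg]] := @exists_min_degree _ _ [set: 'I_n]
  (fun (e : {set 'I_n}) z => z \in e) D E.
  by rewrite cardsT card_ord.
have uE' : uniform r E'.
  by apply/forall_inP=> e /(subsetP E'E); exact: (forall_inP uE e).
have lE' : linear_hypergraph E'.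
  apply/forall_inP=> e /(subsetP E'E) eE; apply/forall_inP=> f /(subsetP E'E) fE.
  exact: (forall_inP (forall_inP lE e eE) f fE).
have noC' : ~~ contains_copy (linear_cycle r l) E'.
  apply: contra noC => /existsP[f /andP[fi /forall_inP hf]].
  apply/existsP; exists f; rewrite fi; apply/forall_inP=> e /hf.
  exact: (subsetP E'E).
have [e0 e0E] := set0Pn _ E'0.
have [x xe0] : exists x, x \in e0.
  by apply/set0Pn; rewrite -card_gt0 (eqP (forall_inP uE' e0 e0E)) (leq_trans _ r3).
rewrite -(card_ord n); apply: (level_growth r3 uE' lE' _ noC' e0E xe0).
by move=> z e eE' ze; apply: (deg z e).
Qed.

Local Open Scope ring_scope.

Import Order.TTheory GRing.Theory Num.Theory.

Theorem theorem1p3 (R : realType) (r l : nat) (hr : (3 <= r)%N) (hl : (3 <= l)%N) :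
  exists alpha : R, 0 < alpha /\
    forall n : nat, (0 < n)%N ->
      (exL r n (linear_cycle r l))%:R
        <= alpha * powR n%:R (1 + (l %/ 2)%:R^-1).
Proof.
(* With [t = n ^ (1 / k)] and [D] about [M / n], growth gives [D - G <= G * t]; then [D + 1 <= G * t
   + G + 1 <= (2 * G + 1) * t] because [t >= 1]. *)
set G := growth_const r l; exists (G.*2.+1)%:R; split; first by rewrite ltr0n.
move=> n n0; set M := exL _ _ _; rewrite divn2.
have k0 : (0 < l./2)%N by clear -hl; lia.
set k := l./2 in k0 *; pose t : R := powR n%:R k%:R^-1.
have tk : t ^+ k = n%:R.
  rewrite -powR_mulrn ?powR_ge0 // -powRrM mulVf ?pnatr_eq0 -?lt0n //.
  by rewrite powRr1 // ler0n.
have t0 : 0 <= t by exact: powR_ge0.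
have t1 : 1 <= t.
  by rewrite -(@ler_pXn2r _ k) ?nnegrE ?ler01 // expr1n tk ler1n.
rewrite powRD; last by rewrite pnatr_eq0 -lt0n n0 implybT.
rewrite powRr1 ?ler0n // -/t.
case: (posnP M) => [->|M0]; first by rewrite !mulr_ge0 ?ler0n.
(* The largest [D] with [D * n < M]; the predecessor keeps this strict when [n] divides [M]. *)
pose D := (M.-1 %/ n)%N.
have DM : (D * n < M)%N by have := leq_trunc_div M.-1 n; rewrite -/D; clear -M0; lia.
have MD : (M <= D.+1 * n)%N.
  by have := ltn_ceil M.-1 n0; rewrite -/D; clear -M0; lia.
have le := exL_growth hr hl DM; rewrite -/G -/k in le.
clearbody G.
have leD : (D - G)%:R <= G%:R * t.
  rewrite -(@ler_pXn2r _ k) ?nnegrE ?mulr_ge0 ?ler0n // exprMn tk.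
  by rewrite -!natrX -natrM ler_nat.
have leD' : D.+1%:R <= G.*2.+1%:R * t.
  have : (D.+1 <= (D - G) + G + 1)%N by clear; lia.
  rewrite -(ler_nat R) !natrD => /le_trans; apply.
  have -> : G.*2.+1%:R * t = G%:R * t + G%:R * t + 1 * t.
    by rewrite -!mulrDl -addnn -addn1 !natrD.
  rewrite mul1r; apply: lerD; last exact: t1.
  by apply: lerD => //; rewrite ler_peMr // ler0n.
apply: (@le_trans _ _ (D.+1 * n)%:R); first by rewrite ler_nat.
by rewrite natrM mulrCA mulrC ler_wpM2l ?ler0n.
Qed.
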